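(* Let $P_{\vec n}(x)=P_{\vec n}(x;\alpha_1,\dots,\alpha_p,\beta)$ (type II, monic) and $P^{(i)}_{\vec n}(x)=P^{(i)}_{\vec n}(x;\alpha_1,\dots,\alpha_p,\beta)$, $i\in\{1,\dots,p\}$ (type I), be the Jacobi--Piñeiro multiple orthogonal polynomials given in the context, where $\alpha_1,\dots,\alpha_p,\beta>-1$ and $\alpha_i-\alpha_j\notin\mathbb Z$ for $i\neq j$. Then these polynomials satisfy the respective nearest-neighbor recurrence relations $$xP_{\vec n}(x)=P_{\vec n+\vec e_k}(x)+b^0_{\vec n}(k)P_{\vec n}(x)+\sum_{j=1}^p b^j_{\vec n}P_{\vec n-\vec s_j}(x),$$ $$xP^{(i)}_{\vec n}(x)=P^{(i)}_{\vec n-\vec e_k}(x)+b^0_{\vec n-\vec e_k}(k)P^{(i)}_{\vec n}(x)+\sum_{j=1}^p b^j_{\vec n+\vec s_{j-1}}P^{(i)}_{\vec n+\vec s_j}(x),\qquad i\in\{1,\dots,p\},$$ with respect to the coefficients $$b^0_{\vec n}(k)=\frac{\alpha_k+n_k+1}{\alpha_k+\beta+n_k+|\vec n|+2}\prod_{q=1}^p\frac{\alpha_k-\alpha_q+n_k+1}{\alpha_k-\alpha_q+n_k+1-n_q}+\sum_{i=1}^p\frac{(\alpha_i+n_i)(\alpha_k+\beta+n_k+|\vec n|+1)}{(\alpha_i+\beta+n_i+|\vec n|)_2\,(\alpha_i-\alpha_k-n_k+n_i-1)}\,\frac{\prod_{q=1}^p(\alpha_i-\alpha_q+n_i)}{\prod_{q=1,q\ne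 i}^p(\alpha_i-\alpha_q+n_i-n_q)},$$ and, for $j\in\{1,\dots,p\}$, $$b^j_{\vec n}=(\beta+|\vec n|-j+1)_j\prod_{q=1}^p\frac{(\alpha_q+\beta+|\vec n|-j+1)_j}{(\alpha_q+\beta+|\vec n|-j+n_q+1)_j}\sum_{i\in S(\pi,j)}\frac{\alpha_i+n_i}{(\alpha_i+\beta+n_i+|\vec n|-j)_{j+2}}\,\frac{\prod_{q=1}^p(\alpha_i-\alpha_q+n_i)}{\prod_{q\in S(\pi,j),\,q\ne i}(\alpha_i-\alpha_q+n_i-n_q)\prod_{q\in S^{\mathsf c}(\pi,j)}(\alpha_q+\beta+|\vec n|-j+n_q)} .$$
   Context: Here $p\in\mathbb N$; $\vec n=(n_1,\dots,n_p)\in\mathbb N_0^p$ is a multi-index with $|\vec n|=n_1+\cdots+n_p$; $(x)_0=1$ and $(x)_n=x(x+1)\cdots(x+n-1)$ for $n\in\mathbb N$ are the Pochhammer symbols; $\vec e_k$ is the $k$-th vector of the canonical basis of $\mathbb R^p$, $k\in\{1,\dots,p\}$. Further, $(\pi(1),\dots,\pi(p))$ is a permutation of $(1,\dots,p)$, $\vec s_0=\vec 0$, $\vec s_j=\sum_{i=1}^j\vec e_{\pi(i)}$ for $j\in\{1,\dots,p\}$, $S(\pi,j)=\{i\in\{1,\dots,p\}: j\le\pi^{-1}(i)\}$ and $S^{\mathsf c}(\pi,j)=\{1,\dots,p\}\setminus S(\pi,j)$. The Jacobi--Piñeiro polynomials are the multiple orthogonal polynomials for the weights $w_i(x)=x^{\alpha_i}$,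 $i\in\{1,\dots,p\}$, and the measure $d\mu(x)=(1-x)^\beta dx$ on $[0,1]$: the monic type II polynomials satisfy $\int_0^1x^jP_{\vec n}(x)x^{\alpha_i}(1-x)^\beta dx=0$ for $i\in\{1,\dots,p\}$, $j\in\{0,\dots,n_i-1\}$, with $\deg P_{\vec n}\le|\vec n|$; the type I polynomials satisfy $\deg P^{(i)}_{\vec n}\le n_i-1$ and $\sum_{i=1}^p\int_0^1x^jP^{(i)}_{\vec n}(x)x^{\alpha_i}(1-x)^\beta dx$ equals $0$ for $j\in\{0,\dots,|\vec n|-2\}$ and $1$ for $j=|\vec n|-1$. The condition $\alpha_i-\alpha_j\notin\mathbb Z$ for $i\ne j$ ensures that the weights form an AT (algebraic Chebyshev) system. Type I polynomials: $$P^{(i)}_{\vec n}(x)=(-1)^{|\vec n|-1}\frac{\prod_{q=1}^p(\alpha_q+\beta+|\vec n|)_{n_q}}{(n_i-1)!\prod_{q=1,q\neq i}^p(\alpha_q-\alpha_i)_{n_q}}\,\frac{\Gamma(\alpha_i+\beta+|\vec n|)}{\Gamma(\beta+|\vec n|)\Gamma(\alpha_i+1)}\sum_{l=0}^{n_i-1}\frac{(-n_i+1)_l(\alpha_i+\beta+|\vec n|)_l}{l!\,(\alpha_i+1)_l}\prod_{q=1,q\ne i}^p\frac{(\alpha_i-\alpha_q-n_q+1)_l}{(\alpha_i-\alpha_q+1)_l}\,x^l .$$ Monic type II polynomials: $P_{\vec n}(x)=\sum_{l_1=0}^{n_1}\cdots\sum_{l_p=0}^{n_p}C_{\vec n}^{l_1,\dots,l_p}x^{l_1+\cdots+l_p}$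 with $$\begin{aligned}C_{\vec n}^{l_1,\dots,l_p}={}&(-1)^{|\vec n|}\prod_{q=1}^p\left[\frac{(\alpha_q+1)_{n_q}}{(\alpha_q+\beta+|\vec n|+1)_{n_q}}\frac{(-n_q)_{l_q}}{l_q!}\right]\frac{(\alpha_1+\beta+n_1+1)_{l_1+\cdots+l_p}}{(\alpha_1+1)_{l_1+\cdots+l_p}}\\&\times\frac{(\alpha_1+n_1+1)_{l_2+\cdots+l_p}\cdots(\alpha_{p-1}+n_{p-1}+1)_{l_p}}{(\alpha_1+\beta+n_1+1)_{l_2+\cdots+l_p}\cdots(\alpha_{p-1}+\beta+n_1+\cdots+n_{p-1}+1)_{l_p}}\\&\times\frac{(\alpha_2+\beta+n_1+n_2+1)_{l_2+\cdots+l_p}\cdots(\alpha_p+\beta+|\vec n|+1)_{l_p}}{(\alpha_2+1)_{l_2+\cdots+l_p}\cdots(\alpha_p+1)_{l_p}} .\end{aligned}$$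
   Formalization: Type II needs the zero components of n last in the order π(1),…,π(p), with P_m=0 if m has a negative component (otherwise undefined terms occur); type I needs n_k≥1; 0/0 values of C_n and b^j (when α_q+β=−1) are read as limits in β. *)

(* Defs.v *)
From HB Require Import structures.
From mathcomp Require Import all_boot all_order all_algebra all_fingroup.
From mathcomp Require Import all_classical all_reals all_analysis.
Set Implicit Arguments.
Unset Strict Implicit.
Unset Printing Implicit Defensive.
Import Order.TTheory GRing.Theory Num.Theory.
Import numFieldNormedType.Exports.
Local Open Scope classical_set_scope.
Local Open Scope ring_scope.

(* All indices are 0-based: q : 'I_p stands for q + 1 in {1, ..., p}, and
   pi : 'S_p for the permutation (pi(1), ..., pi(p)). *)

(* (x)_n *)
Definition poch (R : realType) (x : R) (n : nat) : R :=
  \prod_(0 <= m < n) (x + m%:R).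

(* Euler's integral; only used at z > 0. *)
Definition Gamma (R : realType) (z : R) : R :=
  Rintegral (@lebesgue_measure R) `]0, +oo[
    (fun t : R => t `^ (z - 1) * expR (- t)).

(* Several of the quotients of Pochhammer symbols below are 0/0 when
   alpha_q + beta = -1 for some q, which is allowed. As functions of beta their
   singularities are removable, and they are given the value obtained by
   continuity in beta. *)
Definition by_continuity (R : realType) (f : R -> R) (x : R) : R :=
  lim (f y @[y --> x^']).

Section MultiIndices.
Variable p : nat.
Implicit Types (n m : 'I_p -> nat) (pi : 'S_p) (j : nat) (k q : 'I_p).

Definition mlen n : nat := (\sum_(q < p) n q)%N.
Definition madd n m : 'I_p -> nat := fun q => (n q + m q)%N.
(* n - m; only meaningful when m <= n componentwise. *)
Definition msub n m : 'I_p -> nat := fun q => (n q - m q)%N.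
Definition mle m n : bool := [forall q, (m q <= n q)%N].

(* \vec e_k *)
Definition evec k : 'I_p -> nat := fun q => (q == k : nat).
(* \vec s_j, 0 <= j <= p *)
Definition svec pi j : 'I_p -> nat :=
  fun q => (\sum_(i < p | (i < j)%N) evec (pi i) q)%N.
(* S(pi, j), 1 <= j <= p; here j is not shifted, hence the successor. *)
Definition Sset pi j : {set 'I_p} := [set i | (j <= (pi^-1%g i).+1)%N].

End MultiIndices.

Section JacobiPineiro.
Variables (R : realType) (p : nat) (a : 'I_p -> R).
Implicit Types (b : R) (n : 'I_p -> nat) (pi : 'S_p) (j : nat) (i k q r : 'I_p).

(* l_r + ... + l_p is [ltail l r]. *)
Definition ltail (l : 'I_p -> nat) (r : nat) : nat :=
  (\sum_(q < p | (r <= q)%N) l q)%N.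
(* n_1 + ... + n_r is [nhead n r]. *)
Definition nhead n r : nat := (\sum_(q < p | (q <= r)%N) n q)%N.

Definition typeII_formula n (l : 'I_p -> nat) b : R :=
  (-1) ^+ mlen n
  * (\prod_(q < p)
       (poch (a q + 1) (n q) / poch (a q + b + (mlen n)%:R + 1) (n q)
        * (poch (- (n q)%:R) (l q) / (l q)`!%:R)))
  * (\prod_(r < p)
       (poch (a r + b + (nhead n r)%:R + 1) (ltail l r)
        / poch (a r + 1) (ltail l r)))
  * (\prod_(r < p | (r.+1 < p)%N)
       (poch (a r + (n r)%:R + 1) (ltail l r.+1)
        / poch (a r + b + (nhead n r)%:R + 1) (ltail l r.+1))).

Definition typeII_coef n l b : R := by_continuity (typeII_formula n l) b.

(* Monic type II polynomial P_n. The l_q range over {0, ..., n_q}; the bound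
   |n| in the type of l is only there to have a finite type. *)
Definition typeII b n : {poly R} :=
  \sum_(l : {ffun 'I_p -> 'I_(mlen n).+1} | [forall q, (l q <= n q)%N])
     typeII_coef n (fun q => nat_of_ord (l q)) b *: 'X^(\sum_(q < p) l q)%N.

(* P_(n - m), which is 0 when n - m has a negative component. *)
Definition typeII_sub b n m : {poly R} :=
  if mle m n then typeII b (msub n m) else 0.

(* Type I polynomial P^(i)_n, which is 0 for n_i = 0. The product
   (a_i + b + |n|)_(n_i) Gamma(a_i + b + |n|) is written
   Gamma(a_i + b + |n| + n_i): a_i + b + |n| can be a pole of Gamma or
   negative (when n = e_i), whereas a_i + b + |n| + n_i > 0. *)
Definition typeI b n i : {poly R} :=
  ((-1) ^+ (mlen n).-1
   * ((\prod_(q < p | q != i) poch (a q + b + (mlen n)%:R) (n q))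
      / ((n i).-1`!%:R * \prod_(q < p | q != i) poch (a q - a i) (n q)))
   * (Gamma (a i + b + (mlen n)%:R + (n i)%:R)
      / (Gamma (b + (mlen n)%:R) * Gamma (a i + 1))))
  *: \sum_(0 <= l < n i)
       (poch (- (n i)%:R + 1) l * poch (a i + b + (mlen n)%:R) l
        / (l`!%:R * poch (a i + 1) l)
        * \prod_(q < p | q != i)
            (poch (a i - a q - (n q)%:R + 1) l / poch (a i - a q + 1) l))
       *: 'X^l.

(* b^0_n(k). The only denominators that can vanish are the Pochhammer symbols
   in the sum, for n_i = 0; the factor a_i - a_i + n_i of the numerator is then
   0, and so is the term, since x / 0 = 0. *)
Definition bcoef0 b n k : R :=
  (a k + (n k)%:R + 1) / (a k + b + (n k)%:R + (mlen n)%:R + 2)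
  * (\prod_(q < p)
       ((a k - a q + (n k)%:R + 1) / (a k - a q + (n k)%:R + 1 - (n q)%:R)))
  + \sum_(i < p)
      ((a i + (n i)%:R) * (a k + b + (n k)%:R + (mlen n)%:R + 1)
       / (poch (a i + b + (n i)%:R + (mlen n)%:R) 2
          * (a i - a k - (n k)%:R + (n i)%:R - 1))
       * ((\prod_(q < p) (a i - a q + (n i)%:R))
          / \prod_(q < p | q != i) (a i - a q + (n i)%:R - (n q)%:R))).

Definition bcoef_formula pi n j b : R :=
  poch (b + (mlen n)%:R - j%:R + 1) j
  * (\prod_(q < p)
       (poch (a q + b + (mlen n)%:R - j%:R + 1) j
        / poch (a q + b + (mlen n)%:R - j%:R + (n q)%:R + 1) j))
  * \sum_(i in Sset pi j)
      ((a i + (n i)%:R)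
       / poch (a i + b + (n i)%:R + (mlen n)%:R - j%:R) (j + 2)
       * ((\prod_(q < p) (a i - a q + (n i)%:R))
          / ((\prod_(q in Sset pi j | q != i)
                (a i - a q + (n i)%:R - (n q)%:R))
             * \prod_(q in ~: Sset pi j)
                 (a q + b + (mlen n)%:R - j%:R + (n q)%:R)))).

(* b^j_n, 1 <= j <= p *)
Definition bcoef b pi n j : R := by_continuity (bcoef_formula pi n j) b.

End JacobiPineiro.

(* Main.v *)
Require Import Defs.
From HB Require Import structures.
From mathcomp Require Import all_boot all_order all_algebra all_fingroup.
From mathcomp Require Import all_classical all_reals all_analysis.
From mathcomp Require Import measurable_realfun.
From mathcomp Require Import ring lra zify.
Import Order.TTheory GRing.Theory Num.Theory.
Import numFieldNormedType.Exports.
Local Open Scope ring_scope.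

(** Both recurrences are instances of one expansion of the polynomial
    F(t) = t prod_q (t - a_q).  Write w_q = a_q + n_q and N = |n|.

    Type II.  Up to normalisation, the Mellin transform of P(x) (1 - x)^b sends
    x^i to (s + 1)_i / (s + b + 2)_i ([mellin]).  It is injective on polynomials
    ([mellin_inj]), and multiplication by x becomes the shift of s by 1.  Summing
    the multiple sum that defines P_n over one index at a time with the
    Pfaff-Saalschutz formula ([saalschutz], [mellin_multisum]) shows that P_n is
    sent to a constant times
    prod_q (s - a_q)(s - a_q - 1)...(s - a_q - n_q + 1) / (s + b + 2)_N
    ([mellin_typeII]).

    Type I.  The coefficient of x^l in P^(i)_n is a constant times the residue
    at t = a_i + l of
    Gamma(t + b + N) / Gamma(t + 1)
      / prod_q (t - a_q)(t - a_q - 1)...(t - a_q - n_q + 1)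
    ([coef_typeI]).  Gamma enters only through Gamma(z + 1) = z Gamma(z)
    ([GammaS]).

    In both cases, moving n by a unit vector, or x to a neighbouring power,
    changes these products by linear factors.  After division by the common
    factor, the recurrence says that F is a combination of
      (t - u) prod_q (t - w_q)   and
      E_j(t) = prod_(m <= j) (t - z_m) prod_(q in S(pi, j+1)) (t - w_q),
    0 <= j <= p, where S(pi, 1) contains all indices and S(pi, p+1) none, and b^j
    is up to normalisation the coefficient of E_j.  Here t = s + 1,
    u = a_k + n_k + 1, z_m = -(b + 1 + N) + m for type II, and t = a_i + l,
    u = a_k + n_k - 1, z_m = -(b + N - 1) - m for type I.  The coefficient of E_j
    is extracted by a sum of residues over the nodes w_q, q in S(pi, j), together
    with u if j = 0 ([interpolation], [interpolation_perm]), and these are the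
    sums in the formulas for b^j and b^0.

    All this needs nonzero denominators, which are guaranteed when no a_q + b is
    an integer.  The exceptional values of b are isolated, and after cancellation
    of common factors ([typeII_reg], [bcoef_reg], [typeI_reg]) everything is
    continuous in b > -1.  So the quantities defined by continuity are the
    cancelled ones, and the identities extend to all b ([eq_punctured]). *)

Set Implicit Arguments.
Unset Strict Implicit.
Unset Printing Implicit Defensive.

(** * Rising and falling factorials, and interpolation on a chain of nodes *)

Section Poch.
Variable R : realType.
Implicit Types (x y s : R) (n m : nat).

Definition fall x n : R := \prod_(0 <= m < n) (x - m%:R).

Lemma poch0 x : poch x 0 = 1.
Proof. by rewrite /poch big_geq. Qed.

Lemma pochSr x n : poch x n.+1 = poch x n * (x + n%:R).
Proof. by rewrite /poch big_nat_recr. Qed.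

Lemma pochD x m n : poch x (m + n) = poch x m * poch (x + m%:R) n.
Proof.
elim: n => [|n IHn]; first by rewrite addn0 poch0 mulr1.
by rewrite addnS !pochSr IHn natrD -mulrA addrA.
Qed.

Lemma poch1 x : poch x 1 = x.
Proof. by rewrite pochSr poch0 mul1r addr0. Qed.

Lemma pochSl x n : poch x n.+1 = x * poch (x + 1) n.
Proof. by rewrite -add1n pochD poch1. Qed.

Lemma poch_neq0 x n : (forall m, (m < n)%N -> x + m%:R != 0) -> poch x n != 0.
Proof.
by move=> h; rewrite /poch prodf_seq_neq0; apply/allP => m;
  rewrite mem_index_iota; exact: h.
Qed.

Lemma poch_gt0 x n : 0 < x -> 0 < poch x n.
Proof.
move=> x0; rewrite /poch prodr_gt0// => m _.
by rewrite ltr_wpDr.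
Qed.

(** Both sides are the rising factorial of length [m + n] starting at [x]. *)
Lemma pochC x m n : poch x m * poch (x + m%:R) n = poch x n * poch (x + n%:R) m.
Proof. by rewrite -!pochD addnC. Qed.

Lemma fall0 x : fall x 0 = 1.
Proof. by rewrite /fall big_geq. Qed.

Lemma fallSr x n : fall x n.+1 = fall x n * (x - n%:R).
Proof. by rewrite /fall big_nat_recr. Qed.

Lemma fall_poch x n : fall x n = poch (x - n%:R + 1) n.
Proof.
elim: n x => [|n IHn] x; first by rewrite fall0 poch0.
by rewrite fallSr pochSl IHn -natr1 mulrC; congr (_ * poch _ _); ring.
Qed.

Lemma poch_fall x n : poch (- x) n = (-1) ^+ n * fall x n.
Proof.
elim: n => [|n IHn]; first by rewrite fall0 poch0 mulr1.
by rewrite fallSr pochSr IHn exprS; ring.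
Qed.

Lemma fallS_shift x n : fall (x + 1) n * (x + 1 - n%:R) = (x + 1) * fall x n.
Proof.
rewrite -fallSr !fall_poch pochSl -[RHS]mulr1.
rewrite -[in LHS]natr1.
have -> : x + 1 - (n%:R + 1) + 1 = x - n%:R + 1 by ring.
by rewrite -pochSl pochSr mulr1 mulrC; congr (_ * _); ring.
Qed.

Lemma fall_neq0 x n : (forall m, (m < n)%N -> x - m%:R != 0) -> fall x n != 0.
Proof.
by move=> h; rewrite /fall prodf_seq_neq0; apply/allP => m;
  rewrite mem_index_iota; exact: h.
Qed.

End Poch.

Section Interpolation.
Variable R : fieldType.

Lemma lagrange n (r : 'I_n -> R) (F : {poly R}) (s : R) :
  injective r -> (size F <= n)%N ->
  F.[s] = \sum_i F.[r i] * \prod_(q | q != i) ((s - r q) / (r i - r q)).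
Proof.
move=> r_inj sF.
pose P := \sum_i (F.[r i] / \prod_(q | q != i) (r i - r q))
   *: \prod_(q | q != i) ('X - (r q)%:P).
have PE x : P.[x] = \sum_i F.[r i] * \prod_(q | q != i) ((x - r q) / (r i - r q)).
  rewrite /P horner_sum; apply: eq_bigr => i _.
  rewrite hornerZ horner_prod big_split/= prodfV mulrAC mulrA.
  by congr (_ * _ * _); apply: eq_bigr => q _; rewrite !hornerE.
have sP : (size P <= n)%N.
  apply: (leq_trans (size_sum _ _ _)); apply/bigmax_leqP => i _.
  apply: (leq_trans (size_scale_leq _ _)).
  rewrite -big_filter size_prod_XsubC size_filter -sum1_count.
  by rewrite sum1_card cardC1 card_ord; case: (n) i => [[]|].
rewrite -PE; congr horner; apply/eqP; rewrite -subr_eq0; apply/eqP.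
apply: (@roots_geq_poly_eq0 _ _ (map r (enum 'I_n))).
- apply/allP => _ /mapP[i _ ->]; rewrite rootE hornerD hornerN PE subr_eq0.
  apply/eqP; rewrite (bigD1 i)//= [X in _ * X]big1; last first.
    by move=> q qi; rewrite divff// subr_eq0 (inj_eq r_inj) eq_sym.
  rewrite mulr1 [X in _ + X]big1 ?addr0// => j ji.
  by rewrite (bigD1 i) 1?eq_sym//= subrr mul0r mul0r mulr0.
- by rewrite map_inj_uniq// enum_uniq.
- rewrite size_map size_enum_ord (leq_trans (size_polyD _ _))// size_polyN.
  by rewrite geq_max sF.
Qed.

Variables (p : nat) (t z : nat -> R) (F : {poly R}).
Hypothesis t_inj : forall i j, (i <= p)%N -> (j <= p)%N -> t i = t j -> i = j.
Hypothesis tz : forall i m, (i <= p)%N -> (m <= p.+1)%N -> t i != z m.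

(** Up to the factor [t j - z j.+1], the sum of the residues at t_j, ..., t_p
    of F(s) / (prod_(m <= j+1) (s - z_m) prod_(q >= j) (s - t_q)).  This is the
    functional that kills every other member of the family
    E_j(s) = prod_(m <= j) (s - z_m) prod_(q > j) (s - t_q): the quotient has no
    pole among the nodes when the member comes earlier, and residues that sum
    to 0 for degree reasons when it comes later. *)
Definition interp_coef j : R := (t j - z j.+1) *
  \sum_(j <= i < p.+1) F.[t i] / (\prod_(0 <= m < j.+2) (t i - z m)
     * \prod_(j <= q < p.+1 | q != i) (t i - t q)).

(** The multiple of prod_(m <= j) (s - z_m), of degree at most [p.+1], that
    agrees with [F] at the nodes t_j, ..., t_p. *)
Let G j s : R := (\prod_(0 <= m < j.+1) (s - z m)) *
  \sum_(j <= i < p.+1) F.[t i] / (\prod_(0 <= m < j.+1) (t i - z m))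
     * \prod_(j <= q < p.+1 | q != i) ((s - t q) / (t i - t q)).

(** The two sides are multiples of prod_(m <= j) (s - z_m), and their
    difference vanishes at all t_q with q > j, which leaves one free constant.
    Node by node, the identity is
    (s - t_j)(t_i - z) - (s - z)(t_i - t_j) = (s - t_i)(t_j - z), z = z_(j+1). *)
Lemma G_step j s : (j <= p)%N ->
  G j s = G j.+1 s + interp_coef j * ((\prod_(0 <= m < j.+1) (s - z m))
                               * \prod_(j.+1 <= q < p.+1) (s - t q)).
Proof.
move=> jp.
have neq q : (j < q)%N -> q != j by case: ltngtP.
have jz m : (m <= j.+1)%N -> t j - z m != 0.
  by move=> mj; rewrite subr_eq0 tz// (leq_trans mj).
have tt q i : (q <= p)%N -> (i <= p)%N -> q != i -> t i - t q != 0.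
  move=> qp ip; apply: contraNneq => /eqP; rewrite subr_eq0 => /eqP.
  by move=> /(t_inj ip qp) ->.
have first (f : nat -> R) : \prod_(j <= q < p.+1 | q != j) f q
   = \prod_(j.+1 <= q < p.+1) f q.
  rewrite big_ltn_cond//= eqxx /=.
  rewrite big_nat_cond [RHS]big_nat_cond; apply: eq_bigl => q.
  by case: (ltnP j q) => //= jq; rewrite neq// andbT.
have later (f : nat -> R) i : (j < i)%N -> \prod_(j <= q < p.+1 | q != i) f q
   = f j * \prod_(j.+1 <= q < p.+1 | q != i) f q.
  by move=> ji; rewrite big_ltn_cond//= eq_sym neq.
rewrite /G /interp_coef !(big_ltn (_ : (j < p.+1)%N))// first.
rewrite [in LHS]mulrDr [in RHS]mulrDr mulrDl [RHS]addrCA; congr (_ + _).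
  rewrite big_split/= prodfV !first [\prod_(0 <= m < j.+2) _]big_nat_recr//=.
  have h1 := jz j.+1 (leqnn _).
  have h2 : \prod_(0 <= m < j.+1) (t j - z m) != 0.
    rewrite prodf_seq_neq0; apply/allP => m; rewrite mem_index_iota => /andP[_ mj].
    by rewrite jz// ltnW.
  have h3 : \prod_(j.+1 <= q < p.+1) (t j - t q) != 0.
    rewrite prodf_seq_neq0; apply/allP => q; rewrite mem_index_iota => /andP[jq qp].
    by rewrite tt// neq.
  by field; rewrite h1 h2 h3.
rewrite mulr_sumr mulr_sumr mulr_sumr mulr_suml -big_split/=.
rewrite big_nat_cond [RHS]big_nat_cond; apply: eq_bigr => i /andP[/andP[ji ip] _].
rewrite !later// ![\prod_(0 <= m < j.+2) _]big_nat_recr//=.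
have -> : \prod_(j.+1 <= q < p.+1) (s - t q) =
   (s - t i) * \prod_(j.+1 <= q < p.+1 | q != i) (s - t q).
  rewrite (bigD1_seq i) ?mem_index_iota ?ji ?iota_uniq//.
rewrite big_split/= prodfV.
have h1 : t i - z j.+1 != 0 by rewrite subr_eq0 tz.
have h2 : \prod_(0 <= m < j.+1) (t i - z m) != 0.
  rewrite prodf_seq_neq0; apply/allP => m; rewrite mem_index_iota => /andP[_ mj].
  by rewrite subr_eq0 tz// (leq_trans (ltnW mj)).
have h3 : \prod_(j.+1 <= q < p.+1 | q != i) (t i - t q) != 0.
  rewrite prodf_seq_neq0; apply/allP => q; rewrite mem_index_iota => /andP[jq qp].
  by apply/implyP => ?; rewrite tt.
have h4 : t i - t j != 0 by rewrite tt// eq_sym neq.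
by field; rewrite h1 h2 h3 h4.
Qed.

(** [G_step] telescopes to [G 0]; adding the node z_0, where [G 0] vanishes,
    turns [G 0] into the Lagrange interpolant of [F] on [p.+2] points. *)
Lemma interpolation (s : R) : (size F <= p.+2)%N ->
  F.[s] = F.[z 0%N] / (\prod_(0 <= q < p.+1) (z 0%N - t q))
             * (\prod_(0 <= q < p.+1) (s - t q))
    + \sum_(0 <= j < p.+1) interp_coef j * ((\prod_(0 <= m < j.+1) (s - z m))
                               * \prod_(j.+1 <= q < p.+1) (s - t q)).
Proof.
move=> sF.
have -> : \sum_(0 <= j < p.+1) interp_coef j * ((\prod_(0 <= m < j.+1) (s - z m))
                               * \prod_(j.+1 <= q < p.+1) (s - t q)) = G 0 s.
  have -> : G 0 s = G 0 s - G p.+1 s.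
    by rewrite /G [\sum_(p.+1 <= _ < _) _]big_geq ?mulr0 ?subr0.
  rewrite (@telescope_sumr_eq _ 0 p.+1 (fun j => - G j s)) ?opprK 1?addrC//.
  by move=> j /andP[_ jp]; rewrite (G_step s jp); ring.
pose r (i : 'I_p.+2) := if val i is j.+1 then t j else z 0%N.
have r_inj : injective r.
  move=> [[|i] ip] [[|j] jp]; rewrite /r /= => e; apply: val_inj => //=.
  - by have := tz jp (leq0n _); rewrite -e eqxx.
  - by have := tz ip (leq0n _); rewrite e eqxx.
  - by rewrite (t_inj _ _ e).
rewrite (lagrange s r_inj sF) big_ord_recl; congr (_ + _).
  rewrite -mulrA; congr (_ * _).
  rewrite big_mkcond/= big_ord_recl/= mul1r big_split/= prodfV mulrC.
  by rewrite !big_mkord.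
rewrite /G [X in _ = _ * X]big_mkord mulr_sumr; apply: eq_bigr => i _.
rewrite !big_nat1 big_mkcond/= big_ord_recl/= [RHS]mulrC.
have -> : \prod_(i0 < p.+1) (if lift ord0 i0 != lift ord0 i
      then (s - r (lift ord0 i0)) / (r (lift ord0 i) - r (lift ord0 i0)) else 1)
   = \prod_(0 <= q < p.+1 | q != i) ((s - t q) / (t i - t q)).
  rewrite [RHS]big_mkcond big_mkord; apply: eq_bigr => q _.
  by rewrite (inj_eq lift_inj).
have -> : r (lift ord0 i) = t i by [].
have -> : r ord0 = z 0%N by [].
ring.
Qed.

End Interpolation.

Section PermInterpolation.
Variables (R : realType) (p : nat) (pi : 'S_p).

Lemma in_Sset J i : (i \in Sset pi J.+1) = (J <= pi^-1%g i)%N.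
Proof. by rewrite /Sset inE ltnS. Qed.

Lemma big_Sset (T : Type) (idx : T) (op : Monoid.com_law idx) J
    (P : pred nat) (Q : pred 'I_p) (f : nat -> T) (g : 'I_p -> T) :
  (forall i : 'I_p, f i.+1 = g (pi i)) -> (forall i : 'I_p, P i.+1 = Q (pi i)) ->
  \big[op/idx]_(J.+1 <= i < p.+1 | P i) f i =
  \big[op/idx]_(q in Sset pi J.+1 | Q q) g q.
Proof.
move=> fg PQ; rewrite big_add1/= big_geq_mkord [RHS](reindex_inj (@perm_inj _ pi))/=.
by apply: eq_big => i; [rewrite in_Sset permK PQ andbC|rewrite fg].
Qed.

Lemma in_Sset1 i : i \in Sset pi 1.
Proof. by rewrite in_Sset. Qed.

Variables (w : 'I_p -> R) (u : R) (z : nat -> R).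

Definition perm_sum (F : {poly R}) J : R :=
  \sum_(i in Sset pi J) F.[w i] / (\prod_(0 <= m < J.+2) (w i - z m)
    * \prod_(q in Sset pi J | q != i) (w i - w q)).

Definition perm_sum0 (F : {poly R}) : R :=
  F.[u] / ((u - z 0%N) * (u - z 1%N) * \prod_q (u - w q))
   + \sum_i F.[w i] / ((w i - z 0%N) * (w i - z 1%N)
                       * ((w i - u) * \prod_(q | q != i) (w i - w q))).

Hypothesis w_inj : injective w.
Hypothesis wu : forall q, w q != u.
Hypothesis wz : forall q m, w q != z m.
Hypothesis uz : forall m, u != z m.

(** The interpolation formula on the chain u, w_pi(1), ..., w_pi(p), whose
    tails are the sets S(pi, j).  The term of [u] is kept apart because it
    produces b^0, while the others produce b^1, ..., b^p. *)
Lemma interpolation_perm (F : {poly R}) (s : R) : (size F <= p.+2)%N ->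
  F.[s] = F.[z 0%N] / ((z 0%N - u) * \prod_q (z 0%N - w q))
            * ((s - u) * \prod_q (s - w q))
    + ((u - z 1%N) * perm_sum0 F) * ((s - z 0%N) * \prod_q (s - w q))
    + \sum_(j < p) (w (pi j) - z j.+2) * perm_sum F j.+1
        * ((\prod_(0 <= m < j.+2) (s - z m))
           * \prod_(q in Sset pi j.+2) (s - w q)).
Proof.
move=> sF.
pose t n : R := if n is q.+1 then oapp (fun i => w (pi i)) 0 (insub q) else u.
have tS (i : 'I_p) : t i.+1 = w (pi i) by rewrite /= valK.
have tS' i (ip : (i < p)%N) : t i.+1 = w (pi (Ordinal ip)) by rewrite -tS.
have t_inj i j : (i <= p)%N -> (j <= p)%N -> t i = t j -> i = j.
  case: i j => [|i] [|j] // ip jp.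
  - by rewrite tS' => /eqP; rewrite eq_sym (negPf (wu _)).
  - by rewrite tS' => /eqP; rewrite (negPf (wu _)).
  - by rewrite !tS' => /w_inj/perm_inj[->].
have tz i m : (i <= p)%N -> (m <= p.+1)%N -> t i != z m.
  by case: i => [|i] ip _; [exact: uz|rewrite tS' wz].
have prodT (x : R) : \prod_(1 <= q < p.+1) (x - t q) = \prod_q (x - w q).
  rewrite (@big_Sset _ _ _ 0 _ predT _ (fun q => x - w q))//.
    by apply: eq_bigl => q; rewrite in_Sset1.
  by move=> i; rewrite tS.
have prod2 (f : nat -> R) : \prod_(0 <= m < 2) f m = f 0%N * f 1%N.
  by rewrite big_ltn// big_nat1.
rewrite (@interpolation _ p t z F t_inj tz s sF).
rewrite ![\prod_(0 <= q < p.+1) _]big_ltn// !prodT.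
rewrite -[RHS]addrA; congr (_ + _).
rewrite big_ltn//; congr (_ + _).
  rewrite big_nat1 prodT; congr (_ * _); rewrite /interp_coef /perm_sum0; congr (_ * _).
  rewrite big_ltn//; congr (_ + _).
    rewrite prod2; congr (_ / (_ * _)).
    rewrite -prodT big_ltn_cond//=.
    by rewrite big_nat_cond [RHS]big_nat_cond; apply: eq_bigl => -[].
  rewrite (@big_Sset _ _ _ 0 _ predT _ (fun i => F.[w i] / ((w i - z 0%N) * (w i - z 1%N)
                       * ((w i - u) * \prod_(q | q != i) (w i - w q)))))//.
    by apply: eq_bigl => q; rewrite in_Sset1.
  move=> i; rewrite tS prod2; congr (_ / (_ * _)).
  rewrite big_ltn_cond//=; congr (_ * _).
  rewrite (@big_Sset _ _ _ 0 _ (fun q => q != pi i) _ (fun q => w (pi i) - w q)).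
  - by apply: eq_bigl => q; rewrite in_Sset1.
  - by move=> j; rewrite !tS.
  - by move=> j; rewrite eqSS (inj_eq perm_inj).
rewrite big_add1 big_mkord; apply: eq_bigr => j _.
rewrite /interp_coef /perm_sum tS; congr (_ * _ * (_ * _)).
  rewrite (@big_Sset _ _ _ _ predT predT
    _ (fun i => F.[w i] / (\prod_(0 <= m < j.+3) (w i - z m)
      * \prod_(q in Sset pi j.+1 | q != i) (w i - w q))))//.
    by apply: eq_bigl => q; rewrite andbT.
  move=> i; rewrite tS; congr (_ / (_ * _)).
  by apply: big_Sset => q; rewrite ?tS// eqSS (inj_eq perm_inj).
rewrite (@big_Sset _ _ _ _ predT predT _ (fun i => s - w i))//.
  by apply: eq_bigl => q; rewrite andbT.
by move=> i; rewrite tS.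
Qed.

End PermInterpolation.

(** * Lengths of multi-indices, and rising factorials at non-integers *)

Section Mlen.
Variables (p : nat).
Implicit Types (n m : 'I_p -> nat) (pi : 'S_p).

Lemma mlenD n m : mlen (madd n m) = (mlen n + mlen m)%N.
Proof. by rewrite /mlen -big_split. Qed.

Lemma mlen_evec k : mlen (@evec p k) = 1%N.
Proof.
rewrite /mlen (bigD1 k)//= /evec eqxx big1// => i /negPf.
by rewrite eq_sym => ->.
Qed.

Lemma svecE pi j q : svec pi j q = (pi^-1%g q < j)%N.
Proof.
rewrite /svec /evec; case: (ltnP (pi^-1%g q) j) => h.
  rewrite (bigD1 (pi^-1%g q))//= permKV eqxx big1// => i /andP[_].
  by apply: contraNeq; case: (eqVneq q (pi i)) => // -> _; rewrite permK.
rewrite big1// => i ij; case: (eqVneq q (pi i)) => // e; move: h.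
by rewrite e permK leqNgt ij.
Qed.

Lemma mlen_svec pi j : (j <= p)%N -> mlen (svec pi j) = j.
Proof.
move=> jp; rewrite /mlen (reindex_inj (@perm_inj _ pi))/=.
under eq_bigr => i _ do rewrite svecE permK.
transitivity (\sum_(i < p | (i < j)%N) 1)%N.
  by rewrite [RHS]big_mkcond; apply: eq_bigr => i _; case: (_ < _)%N.
by rewrite -(big_ord_widen p (fun=> 1%N) jp) sum1_card card_ord.
Qed.

Lemma mlenB n m : mle m n -> mlen (msub n m) = (mlen n - mlen m)%N.
Proof. by move=> /forallP h; rewrite /mlen -sumnB. Qed.

Lemma leq_mlen n m : mle m n -> (mlen m <= mlen n)%N.
Proof. by move=> /forallP h; rewrite /mlen leq_sum. Qed.

Lemma leq_mlen1 n q : (n q <= mlen n)%N.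
Proof. by rewrite /mlen (bigD1 q)//= leq_addr. Qed.

End Mlen.

Section NonInt.
Variable R : realType.
Implicit Types x e : R.

(** Integer translates of [a i - a q], and of [a q + y] for generic beta = y,
    are nonzero for this reason; most denominators below are of these forms. *)
Lemma nonintDB x e (c d : nat) :
  x \isn't a Num.int -> e = x + c%:R - d%:R -> e \isn't a Num.int.
Proof.
move=> h ->; apply: contra h => h.
have -> : x = (x + c%:R - d%:R) - c%:R + d%:R by ring.
by apply: rpredD; [apply: rpredB => //; exact: natr_int|exact: natr_int].
Qed.

Lemma nonint_neq0 x : x \isn't a Num.int -> x != 0.
Proof. by apply: contraNneq => ->; rewrite rpred0. Qed.

Lemma nonint_poch x n : x \isn't a Num.int -> poch x n != 0.
Proof.
move=> h; apply: poch_neq0 => m _; apply: nonint_neq0.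
by apply: (nonintDB (c := m) (d := 0) h); ring.
Qed.

(** Up to the order of the factors this is [pochC]. *)
Lemma poch_shift x n J : x \isn't a Num.int ->
  poch x J / poch (x + n%:R) J / poch x n = (poch (x + J%:R) n)^-1.
Proof.
move=> h.
have h1 : x + n%:R \isn't a Num.int by apply: (nonintDB (c := n) (d := 0) h); ring.
have h2 : x + J%:R \isn't a Num.int by apply: (nonintDB (c := J) (d := 0) h); ring.
have := pochC x J n; have := nonint_poch J h; have := nonint_poch n h.
have := nonint_poch J h1; have := nonint_poch n h2.
move=> a1 a2 a3 a4 e.
have -> : poch x J = poch x n * poch (x + n%:R) J / poch (x + J%:R) n.
  by rewrite -e mulfK.
by field; rewrite a1 a2 a3.
Qed.

Lemma poch_shift_pred x n J : (0 < n)%N -> x \isn't a Num.int ->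
  poch x J / poch (x + n%:R) J / (x + n%:R - 1) / poch x n.-1
    = (poch (x + J%:R) n)^-1.
Proof.
case: n => // n _ h; rewrite -[RHS]poch_shift// pochSr /= -natr1.
have -> : x + (n%:R + 1) - 1 = x + n%:R by ring.
by rewrite invfM; ring.
Qed.

End NonInt.

(** * The expansion shared by both recurrences *)

Section Base.
Variables (R : realType) (p : nat) (a : 'I_p -> R) (pi : 'S_p) (k : 'I_p).
Hypothesis haZ : forall i j : 'I_p, i != j -> a i - a j \isn't a Num.int.
Implicit Types (n m : 'I_p -> nat) (y t d : R) (J : nat).

Definition node n (q : 'I_p) : R := a q + (n q)%:R.

(** The polynomial whose expansion gives both recurrences: multiplication of
    P_n by x turns the factors t - (a_q + n_q) of the transform into t - a_q. *)
Definition alpha_poly : {poly R} := 'X * \prod_(q < p) ('X - (a q)%:P).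

Lemma horner_alpha_poly t : alpha_poly.[t] = t * \prod_(q < p) (t - a q).
Proof.
rewrite /alpha_poly hornerM hornerX horner_prod; congr (_ * _).
by apply: eq_bigr => q _; rewrite !hornerE.
Qed.

Lemma size_alpha_poly : (size alpha_poly <= p.+2)%N.
Proof.
apply: leq_trans (size_polyMleq _ _) _.
by rewrite size_polyX size_prod_XsubC /index_enum -enumT size_enum_ord.
Qed.

Lemma sub_node_nonint n m i q : i != q -> node n i - node m q \isn't a Num.int.
Proof.
move=> iq; apply: (nonintDB (c := n i) (d := m q) (haZ iq)).
by rewrite /node; ring.
Qed.

Lemma node_inj n : injective (node n).
Proof.
move=> i q e; apply/eqP; apply: contraT => /(@sub_node_nonint n n).
by rewrite e subrr rpred0.
Qed.

(** The sum in the definition of b^j, with [d] for beta + |n| - j. *)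
Definition node_sum n J d : R :=
  \sum_(i in Sset pi J) (node n i / poch (node n i + d) (J + 2)
    * ((\prod_(q < p) (node n i - a q))
       / \prod_(q in Sset pi J | q != i) (node n i - node n q))).

Lemma bcoef_formulaE n J y :
  bcoef_formula a pi n J y = poch (y + (mlen n)%:R - J%:R + 1) J
  * (\prod_(q < p)
       (poch (a q + y + (mlen n)%:R - J%:R + 1) J
        / poch (a q + y + (mlen n)%:R - J%:R + (n q)%:R + 1) J))
  / (\prod_(q in ~: Sset pi J) (a q + y + (mlen n)%:R - J%:R + (n q)%:R))
  * node_sum n J (y + (mlen n)%:R - J%:R).
Proof.
rewrite /bcoef_formula /node_sum -[RHS]mulrA; congr (_ * _).
rewrite mulr_sumr; apply: eq_bigr => i _.
rewrite invfM.
have -> : a i + y + (n i)%:R + (mlen n)%:R - J%:R = node n i + (y + (mlen n)%:R - J%:R).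
  by rewrite /node; ring.
have -> : \prod_(q < p) (a i - a q + (n i)%:R) = \prod_(q < p) (node n i - a q).
  by apply: eq_bigr => q _; rewrite /node; ring.
have -> : \prod_(q in Sset pi J | q != i) (a i - a q + (n i)%:R - (n q)%:R)
   = \prod_(q in Sset pi J | q != i) (node n i - node n q).
  by apply: eq_bigr => q _; rewrite /node; ring.
rewrite /node; ring.
Qed.

Lemma perm_sumE n J d (z : nat -> R) :
  (forall t, \prod_(0 <= m < J.+2) (t - z m) = poch (t + d) (J + 2)) ->
  perm_sum pi (node n) z alpha_poly J = node_sum n J d.
Proof.
move=> zE; apply: eq_bigr => i _; rewrite zE horner_alpha_poly invfM; ring.
Qed.

(** Every node is an integer translate of some [a q] and every [z l] an integer
    translate of [- y], so a generic [y] makes them all distinct. *)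
Lemma base_interpolation y n (u : R) (z : nat -> R) (t : R) :
  (forall q, a q + y \isn't a Num.int) ->
  (forall q, node n q != u) ->
  (exists c d : nat, u = a k + c%:R - d%:R) ->
  (forall l : nat, exists c d : nat, z l = - y + c%:R - d%:R) ->
  t * \prod_q (t - a q) =
    z 0%N * \prod_q (z 0%N - a q) / ((z 0%N - u) * \prod_q (z 0%N - node n q))
            * ((t - u) * \prod_q (t - node n q))
    + ((u - z 1%N) * perm_sum0 (node n) u z alpha_poly)
         * ((t - z 0%N) * \prod_q (t - node n q))
    + \sum_(j < p) (node n (pi j) - z j.+2) * perm_sum pi (node n) z alpha_poly j.+1
        * ((\prod_(0 <= m < j.+2) (t - z m))
           * \prod_(q in Sset pi j.+2) (t - node n q)).
Proof.
move=> hy wu [c [d uE]] zE; rewrite -!horner_alpha_poly.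
have nz q (v : R) : (exists c d : nat, v = - y + c%:R - d%:R) ->
    forall e (c d : nat), e = a q + c%:R - d%:R -> e != v.
  move=> [c1 [d1 ->]] e c2 d2 ->; rewrite -subr_eq0; apply: nonint_neq0.
  by apply: (nonintDB (c := c2 + d1) (d := d2 + c1) (hy q)); rewrite !natrD; ring.
apply: interpolation_perm => //; first exact: node_inj.
- by move=> q l; apply: (nz q _ (zE l) _ (n q) 0%N); rewrite /node subr0.
- by move=> l; apply: (nz k _ (zE l) _ c d).
- exact: size_alpha_poly.
Qed.

End Base.

(** * Type II: the expansion in terms of the recurrence coefficients *)

Section RecII.
Variables (R : realType) (p : nat) (a : 'I_p -> R) (pi : 'S_p) (k : 'I_p).
Hypothesis haZ : forall i j : 'I_p, i != j -> a i - a j \isn't a Num.int.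
Implicit Types (n m : 'I_p -> nat) (y t d : R) (J : nat).

(** The constant of the Mellin transform of the monic type II polynomial; see
    [mellin_typeII]. *)
Definition mellin_scale n y : R := poch (y + 1) (mlen n)
  / \prod_(q < p) poch (a q + y + 1 + (mlen n)%:R) (n q).

Variables (n : 'I_p -> nat) (y : R).
Hypothesis hy : forall q, a q + y \isn't a Num.int.

Let N := mlen n.
Let w := node a n.
Let u := a k + (n k)%:R + 1.
Let z (l : nat) : R := - (y + 1 + N%:R) + l%:R.

Lemma prod_at (c : R) : c = \prod_(q < p) (if q == k then c else 1).
Proof. by rewrite -big_mkcond big_pred1_eq. Qed.

Let nz x (c d : nat) q : x = a q + y + c%:R - d%:R -> x != 0.
Proof. by move=> e; apply: nonint_neq0; apply: (nonintDB (hy q) e). Qed.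

Let nzp x (c d : nat) q l : x = a q + y + c%:R - d%:R -> poch x l != 0.
Proof. by move=> e; apply: nonint_poch; apply: (nonintDB (hy q) e). Qed.

(** The coefficient of (t - u) prod_q (t - w_q), read off at t = z_0, where
    all the other members of the expansion vanish.  That the scale of n + e_k comes
    out without a further factor reflects that P_n and P_(n + e_k) are both
    monic. *)
Lemma mellin_scale_next :
  mellin_scale n y * (z 0%N * \prod_q (z 0%N - a q) / ((z 0%N - u) * \prod_q (z 0%N - w q)))
  = mellin_scale (madd n (evec k)) y.
Proof.
rewrite /mellin_scale mlenD mlen_evec -/N addn1 pochSr.
set c := y + 1 + N%:R.
have zE f : \prod_(q < p) (z 0%N - f q) = (-1) ^+ p * \prod_(q < p) (f q + c).
  rewrite -[p in _ ^+ p]card_ord -prodrN /z addr0.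
  by apply: eq_bigr => q _; rewrite -/c; ring.
rewrite !zE.
have -> : z 0%N = - c by rewrite /z addr0.
(* Factor by factor, (x)_n (x + n) = x (x + 1)_n. *)
have key : (\prod_(q < p) (a q + c)) *
    (\prod_(q < p) poch (a q + y + 1 + N.+1%:R) (madd n (evec k) q)) =
  (\prod_(q < p) poch (a q + y + 1 + N%:R) (n q)) * ((u + c) * \prod_q (w q + c)).
  rewrite [X in _ = _ * (X * _)](prod_at (u + c)) -!big_split/=.
  apply: eq_bigr => q _; rewrite /madd /evec.
  have -> : a q + y + 1 + N.+1%:R = a q + c + 1 by rewrite /c -natr1; ring.
  have -> : a q + y + 1 + N%:R = a q + c by rewrite /c; ring.
  case: eqVneq => [->|_] /=.
    rewrite addn1 -pochSl 2!pochSr -!mulrA; congr (_ * _).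
    by rewrite /w /node /u -natr1; ring.
  by rewrite addn0 -pochSl pochSr mul1r /w /node; congr (_ * _); ring.
have h1 : (-1) ^+ p != 0 :> R by rewrite signr_eq0.
have h2 : \prod_(q < p) poch (a q + y + 1 + N%:R) (n q) != 0.
  by apply/prodf_neq0 => q _; apply: (@nzp _ (N + 1) 0 q); rewrite natrD; ring.
have h3 : \prod_(q < p) (w q + c) != 0.
  apply/prodf_neq0 => q _; apply: (@nz _ (n q + N + 1) 0 q).
  by rewrite /w /node /c !natrD; ring.
have h4 : u + c != 0.
  by apply: (@nz _ (n k + N + 2) 0 k); rewrite /u /c !natrD; ring.
have h5 : \prod_(q < p) poch (a q + y + 1 + N.+1%:R) (madd n (evec k) q) != 0.
  by apply/prodf_neq0 => q _; apply: (@nzp _ (N + 2) 0 q); rewrite !natrD -natr1; ring.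
have h6 : - c - u != 0 by rewrite -opprD oppr_eq0 addrC.
have -> : \prod_(q < p) (a q + c) =
    (\prod_(q < p) poch (a q + y + 1 + N%:R) (n q)) * ((u + c) * \prod_q (w q + c))
    / \prod_(q < p) poch (a q + y + 1 + N.+1%:R) (madd n (evec k) q).
  by rewrite -key mulfK.
by field; rewrite h1 h2 h3 h5 h6.
Qed.

(** Factor by factor, q in S(pi, j+1), q = pi(j) and q outside S(pi, j) are
    the three cases of the rising-factorial identities [poch_shift] and
    [poch_shift_pred]; the case q = pi(j) supplies the factor [w (pi j) + _]. *)
Lemma mellin_scale_bcoef (j : 'I_p) : mle (svec pi j.+1) n ->
  bcoef_formula a pi n j.+1 y * mellin_scale (msub n (svec pi j.+1)) y
  = mellin_scale n y
    * ((w (pi j) + (y + N%:R - j.+1%:R)) * node_sum a pi n j.+1 (y + N%:R - j.+1%:R)).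
Proof.
move=> le_s; rewrite bcoef_formulaE -/N /mellin_scale (mlenB le_s) mlen_svec// -/N.
have jN : (j.+1 <= N)%N by rewrite -(@mlen_svec _ pi j.+1) ?leq_mlen.
set T := node_sum _ _ _ _ _.
have -> : poch (y + 1) N = poch (y + 1) (N - j.+1) * poch (y + N%:R - j.+1%:R + 1) j.+1.
  rewrite -{1}(subnK jN) pochD natrB//; congr (_ * poch _ _); ring.
suff e : (\prod_(q < p) (poch (a q + y + N%:R - j.+1%:R + 1) j.+1
        / poch (a q + y + N%:R - j.+1%:R + (n q)%:R + 1) j.+1))
    / (\prod_(q in ~: Sset pi j.+1) (a q + y + N%:R - j.+1%:R + (n q)%:R))
    / \prod_(q < p) poch (a q + y + 1 + (N - j.+1)%:R) (msub n (svec pi j.+1) q)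
  = (w (pi j) + (y + N%:R - j.+1%:R))
    / \prod_(q < p) poch (a q + y + 1 + N%:R) (n q) :> R.
  transitivity (poch (y + 1) (N - j.+1) * poch (y + N%:R - j.+1%:R + 1) j.+1 * T *
   ((\prod_(q < p) (poch (a q + y + N%:R - j.+1%:R + 1) j.+1
        / poch (a q + y + N%:R - j.+1%:R + (n q)%:R + 1) j.+1))
    / (\prod_(q in ~: Sset pi j.+1) (a q + y + N%:R - j.+1%:R + (n q)%:R))
    / \prod_(q < p) poch (a q + y + 1 + (N - j.+1)%:R) (msub n (svec pi j.+1) q))).
    by ring.
  by rewrite e; ring.
rewrite [\prod_(q in _) _]big_mkcond -!prodf_div.
rewrite [X in X / _](_ : _ =
    \prod_(q < p) (if q == pi j then w q + (y + N%:R - j.+1%:R) else 1)); last first.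
  by rewrite -big_mkcond big_pred1_eq.
rewrite -prodf_div; apply: eq_bigr => q _.
rewrite natrB// inE in_Sset -ltnNge /msub svecE.
set x := a q + y + N%:R - j.+1%:R + 1.
have -> : a q + y + 1 + (N%:R - j.+1%:R) = x by rewrite /x; ring.
have -> : a q + y + 1 + N%:R = x + j.+1%:R by rewrite /x; ring.
have -> : a q + y + N%:R - j.+1%:R + (n q)%:R + 1 = x + (n q)%:R by rewrite /x; ring.
have -> : a q + y + N%:R - j.+1%:R + (n q)%:R = x + (n q)%:R - 1 by rewrite /x; ring.
have hx : x \isn't a Num.int.
  by apply: (nonintDB (c := N.+1) (d := j.+1) (hy q)); rewrite /x -[N.+1%:R]natr1; ring.
have nq : (pi^-1%g q <= j)%N -> (0 < n q)%N.
  by move=> h; have /forallP/(_ q) := le_s; rewrite svecE ltnS h.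
have [qj|qj] := eqVneq q (pi j).
  have pj : pi^-1%g q = j by rewrite qj permK.
  have n0 : (0 < n q)%N by rewrite nq// pj.
  rewrite pj ltnn leqnn invr1 mulr1 subn1 -(poch_shift_pred j.+1 n0 hx).
  have h : x + (n q)%:R - 1 != 0.
    by apply: nonint_neq0; apply: (nonintDB (c := n q) (d := 1) hx); ring.
  have -> : w q + (y + N%:R - j.+1%:R) = x + (n q)%:R - 1.
    by rewrite /w /node /x; ring.
  move: (poch x j.+1) (_^-1) (poch x (n q).-1)^-1 => A B C.
  by field.
have -> : (pi^-1%g q < j.+1)%N = (pi^-1%g q < j)%N.
  rewrite ltnS leq_eqVlt; case: eqP => //= /val_inj e.
  by rewrite -e permKV eqxx in qj.
rewrite /=; case: ltnP => h.
  by rewrite subn1 poch_shift_pred ?mul1r// nq// ltnW.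
by rewrite subn0 invr1 mulr1 poch_shift// mul1r.
Qed.

(** If some component of n along pi(1), ..., pi(J+1) is 0, then so are all
    components over which the sum runs, and each numerator contains the factor
    n_i.  Thus the terms with P_(n - s_j) = 0 have coefficient 0 in the
    expansion. *)
Lemma node_sum_eq0 J d :
  (forall i j : 'I_p, (i <= j)%N -> n (pi i) = 0%N -> n (pi j) = 0%N) ->
  ~~ mle (svec pi J.+1) n -> node_sum a pi n J.+1 d = 0.
Proof.
move=> hn; rewrite negb_forall => /existsP[q]; rewrite svecE -ltnNge => nq.
have [qJ n0] : (pi^-1%g q <= J)%N /\ n q = 0%N.
  by move: nq; rewrite ltnS; case: (_ <= J)%N => //; case: (n q).
rewrite /node_sum big1// => i; rewrite in_Sset => iJ.
have ni : n i = 0%N.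
  have := @hn (pi^-1%g q) (pi^-1%g i) (leq_trans qJ iJ).
  by rewrite !permKV; apply.
have -> : \prod_(q < p) (node a n i - a q) = 0.
  by rewrite (bigD1 i)//= /node ni addr0 subrr mul0r.
by rewrite mul0r mulr0.
Qed.

(** The node [u] gives the first term of b^0, and the nodes a_i + n_i give the
    sum over i. *)
Lemma bcoef0E : bcoef0 a y n k = (u - z 1%N) * perm_sum0 w u z (alpha_poly a).
Proof.
have e1 : u - z 1%N = a k + y + (n k)%:R + N%:R + 1 by rewrite /u /z; ring.
have e0 : u - z 0%N = a k + y + (n k)%:R + N%:R + 2 by rewrite /u /z; ring.
have h1 : u - z 1%N != 0.
  by rewrite e1; apply: (@nz _ (n k + N + 1) 0 k); rewrite !natrD; ring.
have h0 : u - z 0%N != 0.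
  by rewrite e0; apply: (@nz _ (n k + N + 2) 0 k); rewrite !natrD; ring.
rewrite /bcoef0 /perm_sum0 mulrDr -/N; congr (_ + _).
  rewrite -e0 horner_alpha_poly prodf_div.
  have -> : \prod_(q < p) (a k - a q + (n k)%:R + 1) = \prod_(q < p) (u - a q).
    by apply: eq_bigr => q _; rewrite /u; ring.
  have -> : \prod_(q < p) (a k - a q + (n k)%:R + 1 - (n q)%:R) = \prod_(q < p) (u - w q).
    by apply: eq_bigr => q _; rewrite /u /w /node; ring.
  rewrite !invfM; move: (\prod_q (u - w q))^-1 => B.
  by rewrite /u; field; rewrite h0 h1.
rewrite mulr_sumr; apply: eq_bigr => i _; rewrite horner_alpha_poly -e1.
have -> : \prod_(q < p) (a i - a q + (n i)%:R) = \prod_(q < p) (w i - a q).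
  by apply: eq_bigr => q _; rewrite /w /node; ring.
have -> : \prod_(q < p | q != i) (a i - a q + (n i)%:R - (n q)%:R)
   = \prod_(q < p | q != i) (w i - w q).
  by apply: eq_bigr => q _; rewrite /w /node; ring.
have -> : poch (a i + y + (n i)%:R + N%:R) 2 = (w i - z 0%N) * (w i - z 1%N).
  by rewrite pochSr poch1 /w /node /z; ring.
have -> : a i - a k - (n k)%:R + (n i)%:R - 1 = w i - u by rewrite /w /node /u; ring.
rewrite -[a i + _]/(w i) !invfM.
move: (\prod_(q < p) (w i - a q)) (\prod_(q < p | _) _)^-1.
move: (w i - z 0%N)^-1 (w i - z 1%N)^-1 (w i - u)^-1 => A B C D E; ring.
Qed.

(** The type II recurrence after the Mellin transform and division by the common
    factor, at t = s + 1.  The nodes are u = a_k + n_k + 1 and w_q = a_q + n_q,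
    and z_m = -(y + 1 + |n|) + m. *)
Lemma typeII_base_generic t :
  (forall i j : 'I_p, (i <= j)%N -> n (pi i) = 0%N -> n (pi j) = 0%N) ->
  mellin_scale n y * (t * \prod_q (t - a q)) =
    mellin_scale (madd n (evec k)) y * ((t - u) * \prod_q (t - w q))
    + bcoef0 a y n k * mellin_scale n y * ((t + y + 1 + N%:R) * \prod_q (t - w q))
    + \sum_(j < p) (if mle (svec pi j.+1) n
           then bcoef_formula a pi n j.+1 y * mellin_scale (msub n (svec pi j.+1)) y else 0)
        * (poch (t + y + N%:R - j%:R) (j + 2)
           * \prod_(q in Sset pi j.+2) (t - w q)).
Proof.
move=> hn.
have wu q : w q != u.
  have [->|qk] := eqVneq q k.
    by rewrite /w /node /u -[X in X != _]addr0 (inj_eq (addrI _)) eq_sym oner_eq0.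
  rewrite -subr_eq0; apply: nonint_neq0.
  have h : a q - a k \isn't a Num.int by exact: haZ.
  by apply: (nonintDB (c := n q) (d := n k + 1) h); rewrite /w /node /u natrD; ring.
have zp l x : \prod_(0 <= m < l) (x - z m) = poch (x + y + 1 + N%:R - l%:R + 1) l.
  rewrite -[RHS]/(poch (_ - _ + 1) l) -fall_poch /fall; apply: eq_bigr => m _.
  by rewrite /z; ring.
rewrite (base_interpolation (a := a) pi haZ (y := y) (n := n) (u := u) (z := z) (k := k) t hy wu);
  last 2 first.
- by exists (n k + 1)%N, 0%N; rewrite /u natrD; ring.
- by move=> l; exists l, (N + 1)%N; rewrite /z natrD; ring.
rewrite 2!mulrDr -/w mulrA mellin_scale_next; congr (_ + _ + _).
  by rewrite bcoef0E /z; ring.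
rewrite mulr_sumr; apply: eq_bigr => j _.
have -> : \prod_(0 <= m < j.+2) (t - z m) = poch (t + y + N%:R - j%:R) (j + 2).
  by rewrite zp addn2; congr poch; rewrite -[j.+2%:R]natr1 -[j.+1%:R]natr1; ring.
rewrite (@perm_sumE _ _ _ _ _ _ (y + N%:R - j.+1%:R)); last first.
  move=> x; rewrite zp addn2; congr poch.
  by rewrite -[j.+3%:R]natr1 -[j.+2%:R]natr1; ring.
have -> : w (pi j) - z j.+2 = w (pi j) + (y + N%:R - j.+1%:R).
  by rewrite /z -[j.+2%:R]natr1; ring.
rewrite mulrA; congr (_ * _); case: ifPn => le_s; first by rewrite mellin_scale_bcoef.
by rewrite node_sum_eq0// !mulr0.
Qed.

End RecII.

(** * Type I: coefficients as residues *)

Section RecI.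
Variables (R : realType) (p : nat) (a : 'I_p -> R) (pi : 'S_p) (k : 'I_p).
Hypothesis haZ : forall i j : 'I_p, i != j -> a i - a j \isn't a Num.int.
Implicit Types (n m : 'I_p -> nat) (y t : R) (J : nat).

(** The constant in front of the contour integral representing the type I
    functions, without the Gamma factors. *)
Definition residue_scale n y : R := (\prod_(q < p) poch (a q + y + (mlen n)%:R) (n q))
  / poch (y + 1) (mlen n).-1.

Variables (n : 'I_p -> nat) (y : R).
Hypothesis hy : forall q, a q + y \isn't a Num.int.
Hypothesis y0 : -1 < y.
Hypothesis nk : (0 < n k)%N.

Let N := mlen n.
Let w := node a n.
Let u := a k + (n k)%:R - 1.
Let d := y + N%:R - 1.
Let z (l : nat) : R := - d - l%:R.
Let n' := msub n (evec k).

Let N0 : (0 < N)%N. Proof. exact: leq_trans nk (leq_mlen1 _ _). Qed.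

Let ek_le : mle (evec k) n.
Proof. by apply/forallP => q; rewrite /evec; case: eqVneq => // ->. Qed.

Let N'E : mlen n' = N.-1.
Proof. by rewrite mlenB// mlen_evec subn1. Qed.

Let N'R : (N.-1)%:R = N%:R - 1 :> R.
Proof. by rewrite -subn1 natrB. Qed.

Let n'E q : (n' q)%:R = (n q)%:R - (q == k)%:R :> R.
Proof. by rewrite /n' /msub natrB//; exact: (forallP ek_le). Qed.

Let n'k : (n' k)%:R = (n k)%:R - 1 :> R.
Proof. by rewrite n'E eqxx. Qed.

Let n'q q : q != k -> (n' q)%:R = (n q)%:R :> R.
Proof. by move=> qk; rewrite n'E (negPf qk) subr0. Qed.

Let nz x (c c' : nat) q : x = a q + y + c%:R - c'%:R -> x != 0.
Proof. by move=> e; apply: nonint_neq0; apply: (nonintDB (hy q) e). Qed.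

Let nzp x (c c' : nat) q l : x = a q + y + c%:R - c'%:R -> poch x l != 0.
Proof. by move=> e; apply: nonint_poch; apply: (nonintDB (hy q) e). Qed.

Let y1 l : poch (y + 1) l != 0.
Proof. by rewrite gt_eqF// poch_gt0// -ltrBlDr sub0r. Qed.

(** The counterpart of [mellin_scale_next].  For |n| = 1 the truncated
    predecessor in [residue_scale] breaks the relation, but then
    P_(n - e_k) = 0. *)
Lemma residue_scale_pred : (1 < N)%N ->
  residue_scale n y * (z 0%N * \prod_q (z 0%N - a q) / ((z 0%N - u) * \prod_q (z 0%N - w q)))
  = residue_scale n' y.
Proof.
move=> N1; rewrite /residue_scale N'E.
have zE f : \prod_(q < p) (z 0%N - f q) = (-1) ^+ p * \prod_(q < p) (f q + d).
  rewrite -[p in _ ^+ p]card_ord -prodrN /z subr0.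
  by apply: eq_bigr => q _; ring.
rewrite !zE.
have -> : z 0%N = - d by rewrite /z subr0.
have dE : poch (y + 1) N.-1 = poch (y + 1) N.-1.-1 * d.
  have N1' : (0 < N.-1)%N by rewrite -subn1 subn_gt0.
  rewrite -{1}(prednK N1') pochSr -subn1 natrB// N'R /d; congr (_ * _); ring.
have key : (\prod_(q < p) (a q + d)) *
    (\prod_(q < p) poch (a q + y + N%:R) (n q)) =
  (\prod_(q < p) poch (a q + y + N.-1%:R) (n' q)) * ((u + d) * \prod_q (w q + d)).
  rewrite [X in _ = _ * (X * _)](prod_at k (u + d)) -!big_split/=.
  apply: eq_bigr => q _; rewrite N'R.
  have -> : a q + y + N%:R = a q + d + 1 by rewrite /d; ring.
  have -> : a q + y + (N%:R - 1) = a q + d by rewrite /d; ring.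
  rewrite /n' /msub /evec -pochSl pochSr.
  case: eqVneq => [->|_] /=.
    rewrite subn1 -{1}(prednK nk) pochSr -!mulrA; congr (_ * _).
    rewrite /w /node /u.
    have -> : (n k).-1%:R = (n k)%:R - 1 :> R by rewrite -subn1 natrB.
    by ring.
  by rewrite subn0 mul1r /w /node; congr (_ * _); ring.
have h1 : (-1) ^+ p != 0 :> R by rewrite signr_eq0.
have h3 : \prod_(q < p) (w q + d) != 0.
  apply/prodf_neq0 => q _; apply: (@nz _ (n q + N) 1 q).
  by rewrite /w /node /d !natrD; ring.
have h4 : u + d != 0.
  by apply: (@nz _ (n k + N) 2 k); rewrite /u /d !natrD; ring.
have h6 : - d - u != 0 by rewrite -opprD oppr_eq0 addrC.
have -> : \prod_(q < p) poch (a q + y + N.-1%:R) (n' q) =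
  (\prod_(q < p) (a q + d)) * (\prod_(q < p) poch (a q + y + N%:R) (n q)) /
  ((u + d) * \prod_q (w q + d)) by rewrite key mulfK// mulf_neq0.
have := y1 N.-1; rewrite dE mulf_eq0 negb_or => /andP[h7 h8].
by field; rewrite h1 h3 h4 h6 h7 h8.
Qed.

(** Adding s_j does not move the nodes indexed by S(pi, j+1). *)
Lemma node_sum_svec (j : 'I_p) e :
  node_sum a pi (madd n (svec pi j)) j.+1 e = node_sum a pi n j.+1 e.
Proof.
have nodeE i : i \in Sset pi j.+1 -> node a (madd n (svec pi j)) i = node a n i.
  by rewrite in_Sset /node /madd svecE ltnNge => ->; rewrite addn0.
apply: eq_bigr => i iS; rewrite !nodeE//; congr (_ * (_ / _)).
by apply: eq_bigr => q /andP[qS _]; rewrite nodeE.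
Qed.

Lemma residue_scale_bcoef (j : 'I_p) :
  bcoef_formula a pi (madd n (svec pi j)) j.+1 y * residue_scale (madd n (svec pi j.+1)) y
  = residue_scale n y * ((w (pi j) + d + j.+2%:R) * node_sum a pi n j.+1 d).
Proof.
have jp : (j <= p)%N by exact: ltnW.
rewrite bcoef_formulaE /residue_scale !mlenD !mlen_svec// -/N node_sum_svec.
have dE : y + (N + j)%:R - j.+1%:R = d by rewrite natrD /d -natr1; ring.
rewrite dE; set T := node_sum _ _ _ _ _.
have -> : poch (y + 1) (N + j.+1).-1 = poch (y + 1) N.-1 * poch (d + 1) j.+1.
  rewrite -subn1 addnC -addnBA// subn1 addnC pochD N'R; congr (_ * poch _ _).
  by rewrite /d; ring.
have hd : poch (d + 1) j.+1 != 0.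
  have -> : d + 1 = y + 1 + N.-1%:R by rewrite N'R /d; ring.
  by rewrite gt_eqF// poch_gt0// ltr_wpDr ?ler0n// -ltrBlDr sub0r.
suff e : (\prod_(q < p) (poch (a q + y + (N + j)%:R - j.+1%:R + 1) j.+1
        / poch (a q + y + (N + j)%:R - j.+1%:R + (madd n (svec pi j) q)%:R + 1) j.+1))
    / (\prod_(q in ~: Sset pi j.+1) (a q + y + (N + j)%:R - j.+1%:R
                                        + (madd n (svec pi j) q)%:R))
    * \prod_(q < p) poch (a q + y + (N + j.+1)%:R) (madd n (svec pi j.+1) q)
  = (w (pi j) + d + j.+2%:R)
    * \prod_(q < p) poch (a q + y + N%:R) (n q) :> R.
  transitivity (T / poch (y + 1) N.-1 *
   ((\prod_(q < p) (poch (a q + y + (N + j)%:R - j.+1%:R + 1) j.+1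
        / poch (a q + y + (N + j)%:R - j.+1%:R + (madd n (svec pi j) q)%:R + 1) j.+1))
    / (\prod_(q in ~: Sset pi j.+1) (a q + y + (N + j)%:R - j.+1%:R
                                        + (madd n (svec pi j) q)%:R))
    * \prod_(q < p) poch (a q + y + (N + j.+1)%:R) (madd n (svec pi j.+1) q))).
    move: (\prod_(q < p) _) (\prod_(q in _) _)^-1 (\prod_(q < p) _) => A B C.
    by field; rewrite hd y1.
  by rewrite e; ring.
rewrite [\prod_(q in _) _]big_mkcond -!prodf_div -big_split/=.
rewrite [X in X * _](_ : _ =
    \prod_(q < p) (if q == pi j then w q + d + j.+2%:R else 1)); last first.
  by rewrite -big_mkcond big_pred1_eq.
rewrite -big_split/=; apply: eq_bigr => q _.
rewrite inE in_Sset -ltnNge /madd !svecE.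
set x := a q + y + N%:R.
have -> : a q + y + (N + j)%:R - j.+1%:R + 1 = x by rewrite /x natrD -natr1; ring.
have -> : a q + y + (N + j.+1)%:R = x + j.+1%:R by rewrite /x natrD; ring.
have -> : a q + y + (N + j)%:R - j.+1%:R = x - 1 by rewrite /x natrD -natr1; ring.
have hx : x \isn't a Num.int.
  by apply: (nonintDB (c := N) (d := 0) (hy q)); rewrite /x; ring.
have hxp c l : poch (x + c%:R) l != 0.
  apply: nonint_poch.
  by apply: (nonintDB (c := c) (d := 0) hx); ring.
have [qj|qj] := eqVneq q (pi j).
  have pj : pi^-1%g q = j by rewrite qj permK.
  rewrite pj ltnn ltnSn addn0 addn1 invr1 mulr1.
  have := pochC x j.+1 (n q).+1; rewrite [poch x (n q).+1]pochSr -mulrA.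
  have -> : (x + (n q)%:R) * poch (x + (n q).+1%:R) j.+1 =
    poch (x + (n q)%:R) j.+1 * (w q + d + j.+2%:R).
    have -> : x + (n q).+1%:R = x + (n q)%:R + 1 by rewrite -natr1; ring.
    rewrite -pochSl pochSr; congr (_ * _).
    by rewrite /x /w /node /d -[j.+2%:R]natr1; ring.
  have -> : x - 1 + (n q)%:R + 1 = x + (n q)%:R by ring.
  have := hxp (n q) j.+1; move: (poch (x + (n q)%:R) j.+1) => A hA e.
  by rewrite mulrAC e; field.
have -> : (pi^-1%g q < j.+1)%N = (pi^-1%g q < j)%N.
  rewrite ltnS leq_eqVlt; case: eqP => //= /val_inj e.
  by rewrite -e permKV eqxx in qj.
case: ltnP => h; rewrite mul1r ?addn0 ?addn1.
  have := pochC x j.+1 (n q).+1; rewrite [poch x (n q).+1]pochSr -mulrA.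
  have -> : x - 1 + (n q).+1%:R = x + (n q)%:R by rewrite -natr1; ring.
  have -> : x + (n q)%:R + 1 = x + (n q).+1%:R by rewrite -natr1; ring.
  have := hxp (n q) 1%N; rewrite poch1 => hA.
  have := hxp (n q).+1 j.+1; move: (poch (x + (n q).+1%:R) j.+1) => A hA' e.
  by rewrite mulrAC [_ / A * _]mulrAC e; field; rewrite hA hA'.
rewrite invr1 mulr1.
have -> : x - 1 + (n q)%:R + 1 = x + (n q)%:R by ring.
by rewrite mulrAC pochC mulfK.
Qed.

(** Compared with [bcoef0E] at [n'], the chain of type I uses the same set of
    nodes, but a_k + n'_k and a_k + n'_k + 1 exchange the roles of [u] and
    of the k-th node.  The terms i = k of both sums are therefore split off and
    exchanged. *)
Lemma bcoef0_predE : bcoef0 a y n' k = (u - z 1%N) * perm_sum0 w u z (alpha_poly a).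
Proof.
have e1 : u - z 1%N = u + d + 1 by rewrite /z; ring.
have e0 : u - z 0%N = u + d by rewrite /z; ring.
have h0 : u - z 0%N != 0.
  by rewrite e0; apply: (@nz _ (n k + N) 2 k); rewrite /u /d !natrD; ring.
have h1 : u - z 1%N != 0.
  by rewrite e1; apply: (@nz _ (n k + N) 1 k); rewrite /u /d !natrD; ring.
have h2 i : w i - z 0%N != 0.
  by apply: (@nz _ (n i + N) 1 i); rewrite /z /w /node /d !natrD; ring.
have h3 i : w i - z 1%N != 0.
  by apply: (@nz _ (n i + N) 0 i); rewrite /z /w /node /d !natrD; ring.
have wku : w k - u = 1 by rewrite /w /node /u; ring.
rewrite /bcoef0 /perm_sum0 N'E N'R n'k.
rewrite [X in _ + X = _](bigD1 k)//= [X in _ = _ * (_ + X)](bigD1 k)//=.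
rewrite n'k [RHS]mulrDr [X in _ = _ + X]mulrDr [RHS]addrA addrA; congr (_ + _); last first.
  rewrite mulr_sumr; apply: eq_bigr => i ik; rewrite horner_alpha_poly n'q//.
  have -> : \prod_(q < p) (a i - a q + (n i)%:R) = \prod_(q < p) (w i - a q).
    by apply: eq_bigr => q _; rewrite /w /node; ring.
  have -> : \prod_(q < p | q != i) (a i - a q + (n i)%:R - (n' q)%:R)
     = (w i - u) * \prod_(q < p | (q != i) && (q != k)) (w i - w q).
    rewrite (bigD1 k) 1?eq_sym//=; congr (_ * _).
      by rewrite n'k /w /node /u; ring.
    apply: eq_bigr => q /andP[_ qk]; rewrite n'q// /w /node; ring.
  have -> : \prod_(q | q != i) (w i - w q)
     = (w i - w k) * \prod_(q < p | (q != i) && (q != k)) (w i - w q).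
    by rewrite (bigD1 k) 1?eq_sym//=.
  have -> : poch (a i + y + (n i)%:R + (N%:R - 1)) 2 = (w i - z 0%N) * (w i - z 1%N).
    by rewrite pochSr poch1 /w /node /z /d; ring.
  have -> : a i - a k - ((n k)%:R - 1) + (n i)%:R - 1 = w i - w k.
    by rewrite /w /node; ring.
  have -> : a k + y + ((n k)%:R - 1) + (N%:R - 1) + 1 = u - z 1%N.
    by rewrite /z /u /d; ring.
  rewrite -[a i + _]/(w i) !invfM.
  move: (\prod_(q < p) _) (\prod_(q < p | _) _)^-1 (_^-1) (_^-1) (_^-1) (_^-1).
  by move=> A B C D E G; ring.
rewrite addrC; congr (_ + _).
  rewrite horner_alpha_poly.
  have -> : \prod_(q < p) (a k - a q + ((n k)%:R - 1)) = \prod_(q < p) (u - a q).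
    by apply: eq_bigr => q _; rewrite /u; ring.
  have -> : \prod_(q < p | q != k) (a k - a q + ((n k)%:R - 1) - (n' q)%:R)
     = \prod_(q < p | q != k) (u - w q).
    by apply: eq_bigr => q qk; rewrite n'q// /w /node /u; ring.
  have -> : \prod_q (u - w q) = - \prod_(q < p | q != k) (u - w q).
    by rewrite (bigD1 k)//= -opprB wku mulN1r.
  have -> : poch (a k + y + ((n k)%:R - 1) + (N%:R - 1)) 2 = (u - z 0%N) * (u - z 1%N).
    by rewrite pochSr poch1 /u /z /d; ring.
  have -> : a k - a k - ((n k)%:R - 1) + ((n k)%:R - 1) - 1 = -1 :> R by ring.
  have -> : a k + y + ((n k)%:R - 1) + (N%:R - 1) + 1 = u - z 1%N.
    by rewrite /z /u /d; ring.
  rewrite !invfM !invrN !invr1.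
  have -> : a k + ((n k)%:R - 1) = u by rewrite /u; ring.
  move: (\prod_(q < p) _) (\prod_(q < p | _) _)^-1 (_^-1) (_^-1).
  by move=> A B C D; ring.
rewrite horner_alpha_poly prodf_div.
have -> : \prod_(q < p) (a k - a q + ((n k)%:R - 1) + 1) = \prod_(q < p) (w k - a q).
  by apply: eq_bigr => q _; rewrite /w /node; ring.
have -> : \prod_(q < p) (a k - a q + ((n k)%:R - 1) + 1 - (n' q)%:R)
   = \prod_(q < p | q != k) (w k - w q).
  rewrite (bigD1 k)//= n'k.
  have -> : a k - a k + ((n k)%:R - 1) + 1 - ((n k)%:R - 1) = 1 :> R by ring.
  by rewrite mul1r; apply: eq_bigr => q qk; rewrite n'q// /w /node; ring.
have -> : a k + y + ((n k)%:R - 1) + (N%:R - 1) + 2 = w k - z 1%N.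
  by rewrite /z /w /node /d; ring.
have -> : a k + ((n k)%:R - 1) + 1 = w k by rewrite /w /node; ring.
have -> : u - z 1%N = w k - z 0%N by rewrite /z /u /w /node /d; ring.
rewrite wku mul1r invfM; have := h2 k; have := h3 k.
move: (\prod_(q < p) _) (\prod_(q < p | _) _)^-1 (w k - z 0%N) (w k - z 1%N).
by move=> A B C D hD hC; field; rewrite hC hD.
Qed.

Variables (i : 'I_p).
Hypothesis ai : -1 < a i.

(** The residue at t = a_i + l of 1 / fall (t - a_q) m for q = i, and its value
    there for q <> i.  For q = i it is 0 when l >= m, since there is no pole;
    with this convention the two relations below hold for every l, and no
    boundary case of the recurrence has to be treated separately. *)
Definition pole_res (l : nat) (q : 'I_p) (m : nat) : R :=
  if q == i then (if (l < m)%N then (-1) ^+ (m.-1 - l) / (l`!%:R * (m.-1 - l)`!%:R) else 0)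
  else (fall (a i + l%:R - a q) m)^-1.

Lemma pole_resS l q (m : nat) :
  pole_res l q m = pole_res l q m.+1 * (a i + l%:R - a q - m%:R).
Proof.
rewrite /pole_res; case: eqVneq => [->|qi]; last first.
  rewrite fallSr invfM mulfVK//; apply: nonint_neq0.
  have ha : a i - a q \isn't a Num.int by apply: haZ; rewrite eq_sym.
  by apply: (nonintDB (c := l) (d := m) ha); ring.
have -> : a i + l%:R - a i - m%:R = l%:R - m%:R by ring.
rewrite ltnS (leq_eqVlt l m); case: eqVneq => [->|lm] /=.
  by rewrite ltnn subrr mulr0.
case: ifP => [{}lm|]; last by rewrite mul0r.
case: m lm => // m lm; rewrite ltnS in lm.
rewrite /= subSn// factS exprS natrM.
have -> : l%:R - m.+1%:R = - (m - l).+1%:R :> R by rewrite -subSn// natrB 1?ltnW//; ring.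
have h1 : (l`!)%:R != 0 :> R by rewrite pnatr_eq0 -lt0n fact_gt0.
have h2 : ((m - l)`!)%:R != 0 :> R by rewrite pnatr_eq0 -lt0n fact_gt0.
have h3 : (m - l).+1%:R != 0 :> R by rewrite pnatr_eq0.
by move: ((m - l).+1%:R : R) h3 => A h3; field; rewrite h1 h2 h3.
Qed.

Lemma pole_res_shift l q (m : nat) :
  pole_res l q m = pole_res l.+1 q m.+1 * (a i + l.+1%:R - a q).
Proof.
rewrite /pole_res; case: eqVneq => [->|qi]; last first.
  have -> : a i + l%:R - a q = a i + l.+1%:R - a q - 1 by rewrite -natr1; ring.
  set x := a i + l.+1%:R - a q.
  have x0 : x != 0.
    apply: nonint_neq0; have ha : a i - a q \isn't a Num.int by apply: haZ; rewrite eq_sym.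
    by apply: (nonintDB (c := l.+1) (d := 0) ha); rewrite /x; ring.
  have -> : fall x m.+1 = x * fall (x - 1) m.
    by have := fallS_shift (x - 1) m; rewrite subrK fallSr.
  by rewrite invfM mulrAC mulVf ?mul1r.
have -> : a i + l.+1%:R - a i = l.+1%:R by ring.
rewrite ltnS; case: ifP => [lm|]; last by rewrite mul0r.
case: m lm => // m _; rewrite /= subSS factS natrM.
have h1 : (l`!)%:R != 0 :> R by rewrite pnatr_eq0 -lt0n fact_gt0.
have h2 : ((m - l)`!)%:R != 0 :> R by rewrite pnatr_eq0 -lt0n fact_gt0.
have h3 : l.+1%:R != 0 :> R by rewrite pnatr_eq0.
by move: (l.+1%:R : R) h3 => A h3; field; rewrite h1 h2 h3.
Qed.

(** Up to a factor that depends on neither [m] nor [l], the product of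
    [residue_scale m y] and the residue at t = a_i + l of
    Gamma(t + y + |m|) / Gamma(t + 1) / prod_q fall (t - a_q) m_q. *)
Definition residue_coef (m : 'I_p -> nat) (l : nat) : R :=
  residue_scale m y * (poch (a i + y + 1) ((mlen m).-1 + l) / poch (a i + 1) l)
  * \prod_q pole_res l q (m q).

Lemma prod_pole_res_eq0 l : \prod_q pole_res l q (0 : nat) = 0.
Proof. by rewrite (bigD1 i)//= /pole_res eqxx ltn0 mul0r. Qed.

(** All coefficients involved are multiples of one quantity [g], built from
    the poles of 1 / prod_q fall (t - a_q) (n_q + 1) at t = a_i + l.  The
    cofactors are the terms of the expansion with u = a_k + n_k - 1,
    w_q = a_q + n_q and z_m = -(y + |n| - 1) - m. *)
Lemma residue_coef_recurrence l :
  (if l is l'.+1 then residue_coef n l' else 0) =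
    residue_coef n' l + bcoef0 a y n' k * residue_coef n l
    + \sum_(j < p) bcoef_formula a pi (madd n (svec pi j)) j.+1 y
                   * residue_coef (madd n (svec pi j.+1)) l.
Proof.
pose t := a i + l%:R.
have td : t + d != 0.
  by apply: (@nz _ (l + N) 1 i); rewrite /t /d natrD; ring.
pose g := poch (a i + y + 1) (N.-1 + l) / (t + d) / poch (a i + 1) l
          * \prod_q pole_res l q (n q).+1.
have wu q : w q != u.
  have [->|qk] := eqVneq q k.
    rewrite -subr_eq0 (_ : _ - _ = 1) ?oner_eq0// /w /node /u; ring.
  rewrite -subr_eq0; apply: nonint_neq0.
  have h : a q - a k \isn't a Num.int by exact: haZ.
  by apply: (nonintDB (c := n q + 1) (d := n k) h); rewrite /w /node /u natrD; ring.
have zp c x : \prod_(0 <= m < c) (x - z m) = poch (x + d) c.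
  by apply: eq_bigr => m _; rewrite /z; ring.
have prodw : \prod_q pole_res l q (n q) =
    (\prod_q pole_res l q (n q).+1) * \prod_q (t - w q).
  rewrite -big_split/=; apply: eq_bigr => q _; rewrite pole_resS; congr (_ * _).
  by rewrite /t /w /node; ring.
have cIn : residue_coef n l = residue_scale n y * (g * ((t + d) * \prod_q (t - w q))).
  rewrite /residue_coef prodw -/N /g; move: (poch (a i + 1) l)^-1 => A.
  by field.
have shifted (j : 'I_p) : residue_coef (madd n (svec pi j.+1)) l
    = residue_scale (madd n (svec pi j.+1)) y * (g * (poch (t + d) j.+2
        * \prod_(q in Sset pi j.+2) (t - w q))).
  rewrite /residue_coef mlenD mlen_svec// -/N /g.
  have -> : ((N + j.+1).-1 + l = (N.-1 + l) + j.+1)%N.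
    by have := N0; lia.
  rewrite [poch _ (_ + j.+1)]pochD [poch (t + d) _]pochSl.
  have -> : a i + y + 1 + (N.-1 + l)%:R = t + d + 1.
    by rewrite natrD N'R /t /d; ring.
  have -> : \prod_q pole_res l q (madd n (svec pi j.+1) q) =
    (\prod_q pole_res l q (n q).+1) * \prod_(q in Sset pi j.+2) (t - w q).
    rewrite [X in _ = _ * X]big_mkcond -big_split/=.
    apply: eq_bigr => q _; rewrite in_Sset /madd svecE ltnS.
    case: (leqP (pi^-1%g q) j) => h; first by rewrite addn1 mulr1.
    by rewrite addn0 pole_resS /t /w /node; congr (_ * _); ring.
  by move: (poch (a i + 1) l)^-1 => A; field.
have lhs : (if l is l'.+1 then residue_coef n l' else 0)
    = residue_scale n y * (g * (t * \prod_q (t - a q))).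
  rewrite /g /t; case: (l) => [|l'].
    have -> : \prod_q (a i + 0%:R - a q) = 0.
      by rewrite (bigD1 i)//= addr0 subrr mul0r.
    by rewrite !mulr0.
  set t' := a i + l'.+1%:R.
  have t'0 : t' != 0.
    rewrite gt_eqF// /t' -natr1 addrCA ltr_wpDl ?ler0n//.
    by rewrite -ltrBlDr sub0r.
  have td' : t' + d != 0.
    by apply: (@nz _ (l'.+1 + N) 1 i); rewrite /t' /d natrD; ring.
  rewrite /residue_coef -/N addnS !pochSr.
  have -> : a i + y + 1 + (N.-1 + l')%:R = t' + d.
    by rewrite natrD N'R /t' /d -natr1; ring.
  have -> : a i + 1 + l'%:R = t' by rewrite /t' -natr1; ring.
  under eq_bigr => q _ do rewrite pole_res_shift.
  rewrite big_split/= invfM; move: (poch (a i + 1) l')^-1 => A.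
  by field; rewrite t'0 td'.
have prodn' : \prod_q pole_res l q (n' q) =
    (\prod_q pole_res l q (n q).+1) * ((t - u) * \prod_q (t - w q)).
  rewrite mulrCA -prodw mulrC [X in _ = _ * X](prod_at k) -big_split/=.
  apply: eq_bigr => q _; case: (eqVneq q k) => [->|qk].
    rewrite pole_resS /n' /msub /evec eqxx subn1 prednK//; congr (_ * _).
    by rewrite -subn1 natrB// /t /u; ring.
  by rewrite mulr1 /n' /msub /evec (negPf qk) subn0.
have pred : residue_coef n' l =
    residue_scale n y * (z 0%N * \prod_q (z 0%N - a q) / ((z 0%N - u) * \prod_q (z 0%N - w q)))
   * (g * ((t - u) * \prod_q (t - w q))).
  rewrite /residue_coef prodn'; case: (ltnP 1 N) => N1.
    rewrite residue_scale_pred// N'E /g.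
    have -> : (N.-1 + l = (N.-1.-1 + l).+1)%N by lia.
    rewrite pochSr.
    have -> : a i + y + 1 + (N.-1.-1 + l)%:R = t + d.
      have -> : (N.-1.-1 + l)%:R = N%:R - 2 + l%:R :> R.
        by rewrite natrD -subn2 natrB// -subn1 subn_gt0.
      by rewrite /t /d; ring.
    by move: (poch (a i + 1) l)^-1 => A; field.
(* Now N = 1, so [n'] is the zero multi-index and there are no poles at all. *)
  have n'0 q : n' q = 0%N.
    have := leq_mlen1 n' q; rewrite N'E.
    by move: N1; rewrite -subn_eq0 subn1 => /eqP ->; rewrite leqn0 => /eqP.
  have e0 : (\prod_q pole_res l q (n q).+1) * ((t - u) * \prod_q (t - w q)) = 0.
    by rewrite -prodn' -[RHS](prod_pole_res_eq0 l); apply: eq_bigr => q _; rewrite n'0.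
  by rewrite e0 mulr0 /g -[X in _ = _ * X]mulrA e0 !mulr0.
rewrite lhs pred cIn.
rewrite (base_interpolation (a := a) pi haZ (y := y) (n := n) (u := u) (z := z) (k := k) t hy wu);
  last 2 first.
- by exists (n k)%N, 1%N; rewrite /u; ring.
- by move=> c; exists 1%N, (N + c)%N; rewrite /z /d natrD; ring.
rewrite 4!mulrDr -/w; congr (_ + _ + _).
- by ring.
- by rewrite bcoef0_predE {3}/z; ring.
rewrite !mulr_sumr; apply: eq_bigr => j _; rewrite shifted.
rewrite [RHS]mulrA residue_scale_bcoef zp (@perm_sumE _ _ _ _ _ _ d);
  last by move=> x; rewrite zp addn2.
by rewrite /z; ring.
Qed.

End RecI.

(** * The Mellin transform of the type II multiple sum *)

Section Saalschutz.
Variable R : realType.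
Implicit Types (A b s : R) (n l : nat).

(** Equal to (-1)^l 'C(n, l). *)
Definition signed_binom n l : R := poch (- n%:R) l / l`!%:R.

Lemma factR_neq0 l : l`!%:R != 0 :> R.
Proof. by rewrite pnatr_eq0 -lt0n fact_gt0. Qed.

Lemma signed_binom0 n : signed_binom n 0 = 1.
Proof. by rewrite /signed_binom poch0 fact0 invr1 mulr1. Qed.

Lemma signed_binom_last n : signed_binom n n.+1 = 0.
Proof. by rewrite /signed_binom pochSr addNr mulr0 mul0r. Qed.

Lemma signed_binomS n l : signed_binom n.+1 l.+1 = signed_binom n l.+1 - signed_binom n l.
Proof.
rewrite /signed_binom pochSl pochSr.
have -> : - n.+1%:R + 1 = - n%:R :> R by rewrite -natr1; ring.
rewrite factS natrM -!natr1; have := factR_neq0 l.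
have : l%:R + 1 != 0 :> R by rewrite natr1 pnatr_eq0.
by move=> h1 h2; field; rewrite h1 h2.
Qed.

(** The Pfaff-Saalschutz sum, by induction on n.  Pascal's rule turns the sum
    for n+1 into the sum of the differences X_l - X_(l+1), and such a
    difference is a combination of two summands of balanced sums for n, with
    parameters (A+1, b+1, s) and (A+1, b, s+1).  The coefficients have the
    denominator D = A - s + b + n + 1; the lower bound on s keeps it negative
    throughout the induction. *)
Lemma saalschutz n A b s : 0 < A -> -1 < b -> 0 < s ->
  A + b + 2 * n%:R + 1 < s ->
  \sum_(0 <= l < n.+1) signed_binom n l *
     (poch (A + b + n%:R) l * poch s l / (poch A l * poch (s + b + 1) l))
  = poch (b + 1) n * poch (A - s) n / (poch A n * poch (s + b + 1) n).
Proof.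
elim: n A b s => [|n IHn] A b s A0 b0 s0 As.
  by rewrite big_nat1 signed_binom0 !poch0 !mulr1 !mul1r invr1.
pose X l := poch (A + b + n.+1%:R) l * poch s l / (poch A l * poch (s + b + 1) l).
pose Y l := poch ((A + 1) + (b + 1) + n%:R) l * poch s l
            / (poch (A + 1) l * poch (s + (b + 1) + 1) l).
pose Z l := poch ((A + 1) + b + n%:R) l * poch (s + 1) l
            / (poch (A + 1) l * poch ((s + 1) + b + 1) l).
rewrite -/X.
have -> : \sum_(0 <= l < n.+2) signed_binom n.+1 l * X l =
          \sum_(0 <= l < n.+1) signed_binom n l * (X l - X l.+1).
  rewrite big_nat_recl//.
  under eq_bigr => l _ do rewrite signed_binomS mulrBl.
  under [RHS]eq_bigr => l _ do rewrite mulrBr.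
  rewrite !sumrB addrA; congr (_ - _).
  rewrite big_nat_recr//= signed_binom_last mul0r addr0 [RHS]big_nat_recl//.
  by rewrite !signed_binom0.
(* x and -(n + x) solve (b + 1)(A - s) - n (s + l) =
   x (A + b + n + 1 + l) - (n + x)(s + l) for all l. *)
pose D := A - s + b + n%:R + 1.
have n0 : 0 <= n%:R :> R by rewrite ler0n.
have nS : n.+1%:R = n%:R + 1 :> R by rewrite natr1.
have D0 : D < 0 by rewrite /D; move: As; rewrite nS; lra.
pose x := (b + 1) * (A - s) / D.
pose cY := x * (A + b + n%:R + 1) / (A * (s + b + 1)).
pose cZ := - (n%:R + x) * s / (A * (s + b + 1)).
have sb0 : 0 < s + b + 1 by lra.
have Abn : 0 < A + b + n%:R + 1 by lra.
have XYZ l : X l - X l.+1 = cY * Y l + cZ * Z l.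
  have Q (c : R) : 0 < c -> poch (c + 1) l = poch c l * (c + l%:R) / c.
    by move=> c0; rewrite -pochSr pochSl mulrAC mulfV ?mul1r// gt_eqF.
  rewrite /X /Y /Z !pochSr nS.
  have -> : A + 1 + (b + 1) + n%:R = (A + b + n%:R + 1) + 1 by ring.
  have -> : s + (b + 1) + 1 = (s + b + 1) + 1 by ring.
  have -> : s + 1 + b + 1 = (s + b + 1) + 1 by ring.
  have -> : A + 1 + b + n%:R = A + b + n%:R + 1 by ring.
  have -> : A + b + (n%:R + 1) = A + b + n%:R + 1 by ring.
  rewrite (Q A) ?(Q s) ?(Q (s + b + 1)) ?(Q (A + b + n%:R + 1))//.
  have h1 := lt0r_neq0 (poch_gt0 l A0).
  have h2 := lt0r_neq0 (poch_gt0 l sb0).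
  have l0 : 0 <= l%:R :> R by rewrite ler0n.
  have h3 : A + l%:R != 0 by rewrite gt_eqF//; lra.
  have h4 : s + b + 1 + l%:R != 0 by rewrite gt_eqF//; lra.
  have h5 := lt0r_neq0 A0; have h6 := lt0r_neq0 sb0; have h7 := lt0r_neq0 s0.
  have h8 := lt0r_neq0 Abn; have h9 := ltr0_neq0 D0.
  rewrite /cY /cZ /x; move: h9; rewrite /D => h9.
  move: (poch A l) (poch (s + b + 1) l) (poch s l) (poch (A + b + n%:R + 1) l) h1 h2.
  move=> a1 a2 a3 a4 h1 h2.
  by field; rewrite h1 h2 h3 h4 h5 h6 h7 h8 h9.
under eq_bigr => l _ do rewrite XYZ mulrDr (mulrCA _ cY) (mulrCA _ cZ).
rewrite big_split/= -!mulr_sumr /Y /Z !IHn; try (move: As; rewrite nS; lra).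
rewrite !pochSl.
have As0 : A - s < 0 by move: As; rewrite nS; lra.
have b10 : 0 < b + 1 by lra.
have -> : poch (b + 1 + 1) n = poch (b + 1) n * (b + 1 + n%:R) / (b + 1).
  by rewrite -pochSr pochSl mulrAC mulfV ?mul1r// gt_eqF.
have -> : A + 1 - s = A - s + 1 by ring.
have -> : poch (A - s + 1) n = poch (A - s) n * (A - s + n%:R) / (A - s).
  by rewrite -pochSr pochSl mulrAC mulfV ?mul1r// lt_eqF.
have -> : A + 1 - (s + 1) = A - s by ring.
have -> : s + (b + 1) + 1 = s + b + 1 + 1 by ring.
have -> : s + 1 + b + 1 = s + b + 1 + 1 by ring.
have h1 : poch (A + 1) n != 0 by rewrite gt_eqF// poch_gt0//; lra.
have h2 : poch (s + b + 1 + 1) n != 0 by rewrite gt_eqF// poch_gt0//; lra.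
have h3 := lt0r_neq0 A0; have h4 := lt0r_neq0 sb0; have h5 := ltr0_neq0 D0.
have h6 := ltr0_neq0 As0; have h7 := lt0r_neq0 b10.
rewrite /cY /cZ /x; move: h5; rewrite /D => h5.
move: (poch (A + 1) n) (poch (s + b + 1 + 1) n) (poch (A - s) n) (poch (b + 1) n) h1 h2.
move=> a1 a2 a3 a4 h1 h2.
by field; rewrite h1 h2 h3 h4 h5 h6 h7.
Qed.

End Saalschutz.

Section MultiSum.
Variable R : realType.

Lemma ltail0S p (l : 'I_p.+1 -> nat) :
  ltail l 0 = (l ord0 + ltail (fun q => l (lift ord0 q)) 0)%N.
Proof. by rewrite /ltail big_ord_recl. Qed.

Lemma ltailS p (l : 'I_p.+1 -> nat) r :
  ltail l r.+1 = ltail (fun q => l (lift ord0 q)) r.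
Proof. by rewrite /ltail big_mkcond big_ord_recl [RHS]big_mkcond /= add0n. Qed.

Lemma nheadS p (n : 'I_p.+1 -> nat) (r : 'I_p) :
  nhead n (lift ord0 r) = (n ord0 + nhead (fun q => n (lift ord0 q)) r)%N.
Proof.
by rewrite /nhead big_mkcond big_ord_recl; congr addn; rewrite [RHS]big_mkcond.
Qed.

Lemma nhead0 p (n : 'I_p.+1 -> nat) : nhead n ord0 = n ord0.
Proof. by rewrite /nhead big_mkcond big_ord_recl big1 //= addn0. Qed.

(** The part of the type II coefficients that depends on l.  The
    quotient (x)_(l_r + T) / (x)_T, with x = a_r + b + n_1 + ... + n_r + 1 and
    T = l_(r+1) + ... + l_p, is simplified to (x + T)_(l_r), which has no
    singularity in [b]. *)
Definition typeII_reg_prod p (a : 'I_p -> R) (b : R) (n l : 'I_p -> nat) : R :=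
  \prod_(q < p) (signed_binom R (n q) (l q)
    * poch (a q + b + (nhead n q)%:R + 1 + (ltail l q.+1)%:R) (l q)
    * poch (a q + (n q)%:R + 1) (ltail l q.+1)
    / poch (a q + 1) (ltail l q)).

Lemma big_ffunS p M (P : pred {ffun 'I_p.+1 -> 'I_M.+1})
    (F : {ffun 'I_p.+1 -> 'I_M.+1} -> R) :
  let c (v : 'I_M.+1) (l : {ffun 'I_p -> 'I_M.+1}) :=
    [ffun q : 'I_p.+1 => oapp l v (unlift ord0 q)] in
  \sum_(l | P l) F l = \sum_l \sum_(v | P (c v l)) F (c v l).
Proof.
move=> c; rewrite pair_big_dep/=.
rewrite (reindex (fun x : {ffun 'I_p -> 'I_M.+1} * 'I_M.+1 => c x.2 x.1))//=.
exists (fun l => ([ffun q => l (lift ord0 q)], l ord0)) => [[l v] _|l _] /=.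
  rewrite /c ffunE unlift_none /=; congr pair; apply/ffunP => q.
  by rewrite !ffunE liftK.
apply/ffunP => q; rewrite ffunE; case: unliftP => [j ->|->] /=; by rewrite ?ffunE.
Qed.

(** The sum over l_1 is a Saalschutz sum with A = a_1 + 1 + T and
    s + 1 + T, where T = l_2 + ... + l_p.  Its value turns the remaining sum into
    the same sum for p - 1 indices, with b + n_1 instead of b. *)
Lemma mellin_multisum p M (a : 'I_p -> R) (b s : R) (n : 'I_p -> nat) :
  (forall q, -1 < a q) -> -1 < b -> 0 < s -> (forall q, (n q <= M)%N) ->
  (forall q, a q + b + 2 * (mlen n)%:R + 1 < s) ->
  \sum_(l : {ffun 'I_p -> 'I_M.+1} | [forall q, (l q <= n q)%N])
     typeII_reg_prod a b n (fun q => l q)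
     * (poch (s + 1) (ltail (fun q => l q) 0)
        / poch (s + b + 2) (ltail (fun q => l q) 0))
  = poch (b + 1) (mlen n) * (\prod_q (poch (a q - s) (n q) / poch (a q + 1) (n q)))
    / poch (s + b + 2) (mlen n).
Proof.
elim: p a b n => [|p IHp] a b n ha hb s0 nM hs.
  rewrite (big_pred1 [ffun=> ord0]); last first.
    move=> l; transitivity true; first by apply/forallP => -[].
    by apply/esym/eqP/ffunP => -[].
  by rewrite /typeII_reg_prod /mlen /ltail !big_ord0 !poch0 !mul1r invr1.
pose n' (q : 'I_p) := n (lift ord0 q); pose a' (q : 'I_p) := a (lift ord0 q).
have nE : mlen n = (n ord0 + mlen n')%N by rewrite /mlen big_ord_recl.
(* The index l_1 is split off, so that the inner sum runs over it. *)
rewrite big_ffunS/=.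
pose c (v : 'I_M.+1) (l : {ffun 'I_p -> 'I_M.+1}) :=
    [ffun q : 'I_p.+1 => oapp l v (unlift ord0 q)].
have c0 v l : c v l ord0 = v by rewrite ffunE unlift_none.
have cS v l q : c v l (lift ord0 q) = l q by rewrite ffunE liftK.
transitivity (\sum_(l : {ffun 'I_p -> 'I_M.+1} | [forall q, (l q <= n' q)%N])
  \sum_(v < M.+1 | (v <= n ord0)%N) typeII_reg_prod a b n (fun q => c v l q)
    * (poch (s + 1) (ltail (fun q => c v l q) 0)
        / poch (s + b + 2) (ltail (fun q => c v l q) 0))).
  rewrite [RHS]big_mkcond/=; apply: eq_bigr => l _.
  have PE v : [forall q, (c v l q <= n q)%N]
     = [forall q, (l q <= n' q)%N] && (v <= n ord0)%N.
    apply/forallP/andP => [h|[/forallP h hv] q].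
      split; last by have := h ord0; rewrite c0.
      by apply/forallP => q; have := h (lift ord0 q); rewrite cS.
    by case: (unliftP ord0 q) => [j ->|->]; rewrite ?c0// cS; exact: h.
  case: ifPn => hl; first by apply: eq_bigl => v; rewrite PE hl.
  by rewrite big_pred0// => v; rewrite PE (negPf hl).
pose C := poch (b + 1) (n ord0) * (poch (a ord0 - s) (n ord0) / poch (a ord0 + 1) (n ord0))
   / poch (s + b + 2) (n ord0).
transitivity (\sum_(l : {ffun 'I_p -> 'I_M.+1} | [forall q, (l q <= n' q)%N])
  C * (typeII_reg_prod a' (b + (n ord0)%:R) n' (fun q => l q) *
    (poch (s + 1) (ltail (fun q => l q) 0)
        / poch (s + (b + (n ord0)%:R) + 2) (ltail (fun q => l q) 0)))); last first.
  rewrite -mulr_sumr IHp//; last 4 first.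
  - by move=> q; exact: ha.
  - by have := ler0n R (n ord0); lra.
  - by move=> q; exact: nM.
  - move=> q; apply: le_lt_trans (hs (lift ord0 q)); rewrite nE natrD /a'.
    by have := ler0n R (n ord0); lra.
  rewrite nE !pochD big_ord_recl /C.
  have -> : b + (n ord0)%:R + 1 = b + 1 + (n ord0)%:R by ring.
  have -> : s + (b + (n ord0)%:R) + 2 = s + b + 2 + (n ord0)%:R by ring.
  rewrite !invfM.
  move: (poch (s + b + 2) _)^-1 (poch (s + b + 2 + _) _)^-1 (poch (a ord0 + 1) _)^-1.
  by move=> A B D; rewrite /a' /n'; ring.
apply: eq_bigr => l _.
pose T := ltail (fun q => l q) 0.
have tS v r : ltail (fun q => c v l q) r.+1 = ltail (fun q => l q) r.
  by rewrite ltailS; apply: eq_bigr => q _; rewrite cS.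
have t0 v : ltail (fun q => c v l q) 0 = (v + T)%N.
  by rewrite ltail0S c0; congr addn; apply: eq_bigr => q _; rewrite cS.
have redE v : typeII_reg_prod a b n (fun q => c v l q) =
  signed_binom R (n ord0) v * poch (a ord0 + b + (n ord0)%:R + 1 + T%:R) v
    * poch (a ord0 + (n ord0)%:R + 1) T / poch (a ord0 + 1) (v + T)
  * typeII_reg_prod a' (b + (n ord0)%:R) n' (fun q => l q).
  rewrite /typeII_reg_prod big_ord_recl c0 t0 tS nhead0; congr (_ * _).
  apply: eq_bigr => q _; rewrite cS !tS nheadS natrD.
  by congr (_ * poch _ _ * _ / _); rewrite /a'; ring.
set red' := typeII_reg_prod a' _ n' _; rewrite -/T.
pose A := a ord0 + 1 + T%:R; pose s' := s + 1 + T%:R.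
pose K := poch (a ord0 + (n ord0)%:R + 1) T / poch (a ord0 + 1) T * red'
          * (poch (s + 1) T / poch (s + b + 2) T).
pose f v := signed_binom R (n ord0) v * (poch (A + b + (n ord0)%:R) v * poch s' v
              / (poch A v * poch (s' + b + 1) v)).
have T0 : 0 <= T%:R :> R by rewrite ler0n.
have ha0 := ha ord0; have hs0 := hs ord0.
have n0n : (n ord0)%:R <= (mlen n)%:R :> R by rewrite ler_nat leq_mlen1.
have n00 := ler0n R (n ord0).
transitivity (\sum_(v < M.+1 | (v < (n ord0).+1)%N) K * f v).
  apply: eq_bigr => v _; rewrite redE t0 -/red' ![(v + T)%N]addnC !pochD.
  rewrite /K /f -/A -/s'.
  have -> : a ord0 + b + (n ord0)%:R + 1 + T%:R = A + b + (n ord0)%:R by rewrite /A; ring.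
  have -> : s + b + 2 + T%:R = s' + b + 1 by rewrite /s'; ring.
  by rewrite !invfM; ring.
rewrite -(big_ord_widen M.+1 (fun v => K * f v)) ?ltnS// -mulr_sumr.
rewrite -(big_mkord xpredT f) saalschutz //; last 3 first.
- by rewrite /A; lra.
- by rewrite /s'; lra.
- by rewrite /A /s'; lra.
have P1 : poch A (n ord0) = poch (a ord0 + 1) (n ord0) * poch (a ord0 + (n ord0)%:R + 1) T
    / poch (a ord0 + 1) T.
  have -> : a ord0 + (n ord0)%:R + 1 = a ord0 + 1 + (n ord0)%:R by ring.
  by rewrite pochC mulrC mulKf// gt_eqF// poch_gt0//; lra.
have P2 : poch (s' + b + 1) (n ord0) = poch (s + b + 2) (n ord0)
     * poch (s + (b + (n ord0)%:R) + 2) T / poch (s + b + 2) T.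
  have -> : s + (b + (n ord0)%:R) + 2 = s + b + 2 + (n ord0)%:R by ring.
  have -> : s' + b + 1 = s + b + 2 + T%:R by rewrite /s'; ring.
  by rewrite pochC mulrC mulKf// gt_eqF// poch_gt0//; lra.
have h1 : poch (a ord0 + (n ord0)%:R + 1) T != 0 by rewrite gt_eqF// poch_gt0//; lra.
have h2 : poch (a ord0 + 1) T != 0 by rewrite gt_eqF// poch_gt0//; lra.
have h3 : poch (s + b + 2) T != 0 by rewrite gt_eqF// poch_gt0//; lra.
have h4 : poch (a ord0 + 1) (n ord0) != 0 by rewrite gt_eqF// poch_gt0//; lra.
have h5 : poch (s + b + 2) (n ord0) != 0 by rewrite gt_eqF// poch_gt0//; lra.
have h6 : poch (s + (b + (n ord0)%:R) + 2) T != 0 by rewrite gt_eqF// poch_gt0//; lra.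
rewrite /K /C P1 P2.
have -> : A - s' = a ord0 - s by rewrite /A /s'; ring.
move: (poch (a ord0 + _ + 1) T) (poch (a ord0 + 1) T) (poch (s + b + 2) T)
  (poch (a ord0 + 1) (n ord0)) (poch (s + b + 2) (n ord0))
  (poch (s + (b + _) + 2) T) h1 h2 h3 h4 h5 h6.
move=> x1 x2 x3 x4 x5 x6 h1 h2 h3 h4 h5 h6.
by field; rewrite h1 h2 h3 h4 h5 h6.
Qed.

End MultiSum.

(** * Continuity in the parameter beta *)

Section Continuity.
Local Open Scope classical_set_scope.
Variables (R : realType) (b : R).
Implicit Types f g : R -> R.

Definition cont f := f y @[y --> b] --> f b.

Lemma cont_cst (c : R) : cont (fun=> c).
Proof. exact: cvg_cst. Qed.

Lemma cont_id : cont (fun y => y).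
Proof. exact: cvg_id. Qed.

Lemma contD f g : cont f -> cont g -> cont (fun y => f y + g y).
Proof. exact: cvgD. Qed.

Lemma contM f g : cont f -> cont g -> cont (fun y => f y * g y).
Proof. exact: cvgM. Qed.

Lemma contV f : f b != 0 -> cont f -> cont (fun y => (f y)^-1).
Proof. exact: cvgV. Qed.

Lemma cont_prod (I : Type) (r : seq I) (P : pred I) (F : I -> R -> R) :
  (forall i, P i -> cont (F i)) -> cont (fun y => \prod_(i <- r | P i) F i y).
Proof.
move=> h; elim: r => [|i r IHr].
  by under [X in cont X]eq_fun do rewrite big_nil; exact: cont_cst.
under [X in cont X]eq_fun do rewrite big_cons; case: ifP => // Pi.
by apply: contM => //; exact: h.
Qed.

Lemma cont_sum (I : Type) (r : seq I) (P : pred I) (F : I -> R -> R) :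
  (forall i, P i -> cont (F i)) -> cont (fun y => \sum_(i <- r | P i) F i y).
Proof.
move=> h; elim: r => [|i r IHr].
  by under [X in cont X]eq_fun do rewrite big_nil; exact: cont_cst.
under [X in cont X]eq_fun do rewrite big_cons; case: ifP => // Pi.
by apply: contD => //; exact: h.
Qed.

Lemma cont_poch f n : cont f -> cont (fun y => poch (f y) n).
Proof.
by move=> h; apply: cont_prod => m _; apply: contD => //; exact: cont_cst.
Qed.

Lemma cont_affine c d : cont (fun y => c + y + d).
Proof. by apply: contD; [apply: contD; [exact: cont_cst|exact: cont_id]|exact: cont_cst]. Qed.

Lemma cont_eq (f g : R -> R) : cont f -> f =1 g -> cont g.
Proof. by move=> + /funext <-. Qed.

Lemma cont_pochA (c d : R) n (f : R -> R) : (forall y, f y = c + y + d) ->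
  cont (fun y => poch (f y) n).
Proof.
by move=> h; apply: cont_poch; apply: (cont_eq (@cont_affine c d)) => y; rewrite h.
Qed.

Lemma cont_punctured f : cont f -> f y @[y --> b^'] --> f b.
Proof. by move=> /continuous_withinNx. Qed.

(** The principle by which identities proved for generic beta are extended to
    all beta > -1. *)
Lemma eq_punctured f g : (\forall y \near b^', f y = g y) -> cont f -> cont g ->
  f b = g b.
Proof.
move=> fg cf cg; apply: (cvg_unique _ (cont_punctured cf)) => //.
apply: cvg_trans (cont_punctured cg); apply: near_eq_cvg.
by near=> y; rewrite (near fg y).
Unshelve. all: by end_near. Qed.

Lemma by_continuityE f g : (\forall y \near b^', f y = g y) -> cont g ->
  by_continuity f b = g b.
Proof.
move=> fg cg; apply/cvg_lim => //.
apply: cvg_trans (cont_punctured cg); apply: near_eq_cvg.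
by near=> y; rewrite (near fg y).
Unshelve. all: by end_near. Qed.

(** The integers strictly between ceil(c + b) - 1 and floor(c + b) + 1 can only
    be equal to c + b. *)
Lemma near_nonint (c : R) : \forall y \near b^', c + y \isn't a Num.int.
Proof.
pose m : R := (Num.ceil (c + b) - 1)%:~R - c.
pose M : R := (Num.floor (c + b) + 1)%:~R - c.
have bmM : b \in `]m, M[%R.
  rewrite in_itv/= /m /M ltrBlDl ltrBrDl ceilB1_lt/=.
  by have /andP[] := floor_itv (c + b).
near=> y.
have ymM : y \in `]m, M[%R by near: y; apply: nbhs_dnbhs; exact: near_in_itvoo.
have yb : y != b by near: y; exact: nbhs_dnbhs_neq.
apply/negP => /intrP[z zE]; move/eqP: yb; apply.
move: ymM; rewrite in_itv/= /m /M ltrBlDl ltrBrDl zE !ltr_int ltzD1 => /andP[h1 h2].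
have {}h1 : (Num.ceil (c + b) <= z)%R by rewrite -ltzD1 -ltrBlDr.
have h3 : c + b <= z%:~R by rewrite -ceil_le_int.
have h4 : z%:~R <= c + b by rewrite -floor_ge_int.
by apply: (addrI c); rewrite zE; apply: le_anti; rewrite h3 h4.
Unshelve. all: by end_near. Qed.

Lemma near_generic p (a : 'I_p -> R) : -1 < b ->
  \forall y \near b^', (forall q, a q + y \isn't a Num.int) /\ -1 < y.
Proof.
move=> b1; near=> y; split.
  by near: y; apply: filter_forall => q; exact: near_nonint.
by near: y; apply: nbhs_dnbhs; exact: lt_nbhsr.
Unshelve. all: by end_near. Qed.

End Continuity.

(** * The recurrence coefficients as continuous functions of beta *)

Section Reduced.
Variables (R : realType) (p : nat) (a : 'I_p -> R) (b : R) (pi : 'S_p).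
Hypothesis ha : forall i : 'I_p, -1 < a i.
Hypothesis hb : -1 < b.

(** [bcoef_formula] with the common factors cancelled.  The Pochhammer quotient of
    index q becomes (x_q)_(m_q) / (x_q + J)_(m_q) by [poch_shift].  For q outside
    S(pi, J), and for the index i of the sum, the last factor of the
    numerator cancels a denominator.  The term of i is 0 when m_i = 0,
    because a_i + m_i - a_i divides it.  The remaining denominators are positive for
    beta > -1 and J <= |m|. *)
Definition bcoef_reg (m : 'I_p -> nat) J (y : R) : R :=
  let x q := a q + y + (mlen m)%:R - J%:R + 1 in
  poch (y + (mlen m)%:R - J%:R + 1) J *
  \sum_(i in Sset pi J)
    node a m i * ((\prod_(q < p) (node a m i - a q))
                  / \prod_(q in Sset pi J | q != i) (node a m i - node a m q))
    * (\prod_(q < p | q != i)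
         (poch (x q) (if q \in Sset pi J then m q else (m q).-1) / poch (x q + J%:R) (m q)))
    * (if m i == 0%N then 0
       else poch (x i) (m i).-1 / (poch (x i + J%:R) (m i) * poch (x i + (m i)%:R) J.+1)).

Lemma bcoef_reg_generic m J y : (forall q, a q + y \isn't a Num.int) ->
  (forall q, q \notin Sset pi J -> (0 < m q)%N) ->
  bcoef_formula a pi m J y = bcoef_reg m J y.
Proof.
move=> hy m0; rewrite bcoef_formulaE /bcoef_reg; set M := mlen m.
set x := fun q => a q + y + M%:R - J%:R + 1.
have hx q : x q \isn't a Num.int.
  by apply: (nonintDB (c := M + 1) (d := J) (hy q)); rewrite /x natrD; ring.
have hxJ q (c e : nat) : poch (x q + c%:R) e != 0.
  by apply: nonint_poch; apply: (nonintDB (c := c) (d := 0) (hx q)); ring.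
pose u q := poch (x q) (if q \in Sset pi J then m q else (m q).-1) / poch (x q + J%:R) (m q).
rewrite -[LHS]mulrA -[LHS]mulrA; congr (_ * _).
rewrite mulrA.
have -> : (\prod_(q < p) (poch (a q + y + M%:R - J%:R + 1) J
        / poch (a q + y + M%:R - J%:R + (m q)%:R + 1) J))
    / (\prod_(q in ~: Sset pi J) (a q + y + M%:R - J%:R + (m q)%:R))
   = \prod_q u q.
  rewrite [X in _ / X]big_mkcond -prodf_div; apply: eq_bigr => q _.
  rewrite inE /u -/(x q).
  have -> : a q + y + M%:R - J%:R + (m q)%:R + 1 = x q + (m q)%:R by rewrite /x; ring.
  have -> : a q + y + M%:R - J%:R + (m q)%:R = x q + (m q)%:R - 1 by rewrite /x; ring.
  case: (boolP (q \in _)) => qS /=.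
    by rewrite invr1 mulr1 -[X in _ = _ * X]poch_shift// [RHS]mulrC mulfVK// nonint_poch.
  by rewrite -[X in _ = _ * X]poch_shift_pred ?m0// [RHS]mulrC mulfVK// nonint_poch.
rewrite /node_sum mulr_sumr; apply: eq_bigr => i iS.
rewrite (bigD1 i)//=; case: eqP => mi.
  have -> : \prod_(q < p) (node a m i - a q) = 0.
    by rewrite (bigD1 i)//= /node mi addr0 subrr mul0r.
  by rewrite mul0r mulr0 !mulr0.
have mi0 : (0 < m i)%N by case: (m i) mi.
have -> : \prod_(q < p | q != i) u q = \prod_(q < p | q != i)
         (poch (x q) (if q \in Sset pi J then m q else (m q).-1) / poch (x q + J%:R) (m q)).
  by [].
suff -> : poch (x i) (m i).-1 / (poch (x i + J%:R) (m i) * poch (x i + (m i)%:R) J.+1)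
   = u i / poch (node a m i + (y + M%:R - J%:R)) (J + 2).
  by ring.
rewrite /u iS addn2 [poch (node _ _ _ + _) _]pochSl.
have -> : node a m i + (y + M%:R - J%:R) + 1 = x i + (m i)%:R by rewrite /x /node; ring.
have -> : node a m i + (y + M%:R - J%:R) = x i + (m i).-1%:R.
  by rewrite /x /node -[in LHS](prednK mi0) -natr1; ring.
have -> : poch (x i) (m i) = poch (x i) (m i).-1 * (x i + (m i).-1%:R).
  by rewrite -pochSr prednK.
have h0 : x i + (m i).-1%:R != 0 by have := hxJ i (m i).-1 1%N; rewrite poch1.
by field; rewrite h0 !hxJ.
Qed.

Lemma cont_bcoef_reg m J : (J <= mlen m)%N -> cont b (bcoef_reg m J).
Proof.
move=> JM; have JR : J%:R <= (mlen m)%:R :> R by rewrite ler_nat.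
apply: contM; first by apply: (@cont_pochA _ _ 0 ((mlen m)%:R - J%:R + 1)) => y; ring.
apply: cont_sum => i iS.
apply: contM.
  apply: contM; first exact: cont_cst.
  apply: cont_prod => q qi; apply: contM.
    by apply: (@cont_pochA _ _ (a q) ((mlen m)%:R - J%:R + 1)) => y; ring.
  apply: contV; last by apply: (@cont_pochA _ _ (a q) ((mlen m)%:R + 1)) => y; ring.
  have haq := ha q; have hb1 := hb.
  have [->|mq] := posnP (m q); first by rewrite poch0 oner_eq0.
  have M1 : 1 <= (mlen m)%:R :> R by rewrite ler1n (leq_trans mq (leq_mlen1 _ _)).
  by rewrite gt_eqF// poch_gt0//; lra.
case: eqP => mi; first exact: cont_cst.
have mi1 : 1 <= (m i)%:R :> R by rewrite ler1n lt0n; apply/eqP.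
have M1 : 1 <= (mlen m)%:R :> R.
  by rewrite (le_trans mi1)// ler_nat leq_mlen1.
have hai := ha i; have hb1 := hb.
apply: contM; first by apply: (@cont_pochA _ _ (a i) ((mlen m)%:R - J%:R + 1)) => y; ring.
apply: contV; last first.
  apply: contM; first by apply: (@cont_pochA _ _ (a i) ((mlen m)%:R + 1)) => y; ring.
  by apply: (@cont_pochA _ _ (a i) ((mlen m)%:R - J%:R + 1 + (m i)%:R)) => y; ring.
by rewrite gt_eqF// mulr_gt0// poch_gt0//; lra.
Qed.

Lemma bcoefE m J : (J <= mlen m)%N ->
  (forall q, q \notin Sset pi J -> (0 < m q)%N) ->
  bcoef a b pi m J = bcoef_reg m J b.
Proof.
move=> JM m0; apply: by_continuityE; last exact: cont_bcoef_reg.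
near=> y; apply: bcoef_reg_generic => //.
suff [] : (forall q, a q + y \isn't a Num.int) /\ -1 < y by [].
by near: y; exact: near_generic.
Unshelve. all: by end_near. Qed.

Lemma cont_bcoef0 n k : cont b (fun y => bcoef0 a y n k).
Proof.
have N0 : 0 <= (mlen n)%:R :> R by rewrite ler0n.
apply: contD.
  apply: contM; last exact: cont_cst.
  apply: contM; first exact: cont_cst.
  apply: contV; last first.
    by apply: (cont_eq (@cont_affine _ b (a k) ((n k)%:R + (mlen n)%:R + 2))) => y; ring.
  have := ha k; have := hb; have := ler0n R (n k) => h1 h2 h3; rewrite gt_eqF//; lra.
apply: cont_sum => i _; have [ni|ni] := posnP (n i).
  apply: (cont_eq (@cont_cst R b 0)) => y.
  have -> : \prod_(q < p) (a i - a q + (n i)%:R) = 0.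
    by rewrite (bigD1 i)//= ni addr0 subrr mul0r.
  by rewrite mul0r mulr0.
have hai := ha i; have hb1 := hb.
have ni1 : 1 <= (n i)%:R :> R by rewrite ler1n.
have N1 : 1 <= (mlen n)%:R :> R.
  by rewrite (le_trans ni1)// ler_nat leq_mlen1.
apply: contM; last exact: cont_cst.
apply: contM.
  apply: contM; first exact: cont_cst.
  by apply: (cont_eq (@cont_affine _ b (a k) ((n k)%:R + (mlen n)%:R + 1))) => y; ring.
apply: (@cont_eq _ b (fun y => (poch (a i + y + (n i)%:R + (mlen n)%:R) 2)^-1
    * (a i - a k - (n k)%:R + (n i)%:R - 1)^-1)); last by move=> y; rewrite invfM.
apply: contM; last exact: cont_cst.
apply: contV; last by apply: (@cont_pochA _ _ (a i) ((n i)%:R + (mlen n)%:R)) => y; ring.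
by rewrite gt_eqF// poch_gt0//; lra.
Qed.

End Reduced.

(** * Type II: Mellin transform and recurrence *)

Section Ltail.
Variable p : nat.
Implicit Types l : 'I_p -> nat.

Lemma ltail_rec l (r : 'I_p) : ltail l r = (ltail l r.+1 + l r)%N.
Proof.
rewrite /ltail (bigD1 r)//= addnC; congr addn; apply: eq_bigl => q.
by rewrite ltn_neqAle andbC eq_sym.
Qed.

Lemma ltail_last l r : (p <= r)%N -> ltail l r = 0%N.
Proof.
move=> pr; rewrite /ltail big_pred0// => q.
by apply/negbTE; rewrite -ltnNge (leq_trans (ltn_ord q)).
Qed.

Lemma ltail0 l : ltail l 0 = mlen l.
Proof. by []. Qed.

End Ltail.

Section TypeII.
Variables (R : realType) (p : nat) (a : 'I_p -> R) (b : R).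
Hypothesis ha : forall i : 'I_p, -1 < a i.
Hypothesis hb : -1 < b.
Implicit Types (n l : 'I_p -> nat) (s : R).

(** The type II coefficients with their removable singularities cancelled. *)
Definition typeII_reg n l (y : R) : R :=
  (-1) ^+ mlen n
  * (\prod_(q < p) (poch (a q + 1) (n q) / poch (a q + y + (mlen n)%:R + 1) (n q)))
  * typeII_reg_prod a y n l.

Lemma typeII_formula_generic n l y : (forall q, a q + y \isn't a Num.int) ->
  typeII_formula a n l y = typeII_reg n l y.
Proof.
move=> hy; rewrite /typeII_formula /typeII_reg -!mulrA; congr (_ * _).
rewrite big_split/= -mulrA; congr (_ * _).
rewrite [\prod_(r < p | (r.+1 < p)%N) _]big_mkcond /typeII_reg_prod -!big_split/=.
apply: eq_bigr => r _.
have hr c e : poch (a r + y + c%:R + 1) e != 0.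
  by apply: nonint_poch; apply: (nonintDB (c := c + 1) (d := 0) (hy r)); rewrite natrD; ring.
rewrite /signed_binom ltail_rec pochD.
case: ltnP => rp; last first.
  by rewrite (ltail_last l rp) !add0n !poch0 !addr0 !mul1r; ring.
move: (hr (nhead n r) (ltail l r.+1)) => h.
by move: (_`!%:R)^-1 (poch (a r + 1) _)^-1 => x1 x2; field.
Qed.

Lemma pos_shift n q : n q != 0%N -> 0 < a q + b + (mlen n)%:R + 1.
Proof.
move=> nq; have := ha q; have hb1 := hb.
have : 1 <= (mlen n)%:R :> R by rewrite ler1n (leq_trans _ (leq_mlen1 _ q))// lt0n.
by lra.
Qed.

Lemma poch_shift_neq0 n q : poch (a q + b + (mlen n)%:R + 1) (n q) != 0.
Proof.
have [->|nq] := eqVneq (n q) 0%N; first by rewrite poch0 oner_eq0.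
by rewrite gt_eqF// poch_gt0// pos_shift.
Qed.

Lemma typeII_coefE n l : typeII_coef a n l b = typeII_reg n l b.
Proof.
apply: by_continuityE.
  near=> y; apply: typeII_formula_generic.
  suff [] : (forall q, a q + y \isn't a Num.int) /\ -1 < y by [].
  by near: y; exact: near_generic.
apply: contM.
  apply: contM; first exact: cont_cst.
  apply: cont_prod => q _; apply: contM; first exact: cont_cst.
  apply: contV; first exact: poch_shift_neq0.
  by apply: (@cont_pochA _ _ (a q) ((mlen n)%:R + 1)) => y; ring.
apply: cont_prod => q _; apply: contM; last exact: cont_cst.
apply: contM; last exact: cont_cst.
apply: contM; first exact: cont_cst.
by apply: (@cont_pochA _ _ (a q) ((nhead n q)%:R + 1 + (ltail l q.+1)%:R)) => y; ring.
Unshelve. all: by end_near. Qed.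

(** The quotient of the integrals over [0, 1] of x^(s + i) (1 - x)^b and of
    x^s (1 - x)^b. *)
Definition mellin_mono s i : R := poch (s + 1) i / poch (s + b + 2) i.

(** The number [D] of coefficients taken into account only has to exceed the
    degrees at hand; fixing it makes the functional linear by construction. *)
Definition mellin D s (P : {poly R}) : R := \sum_(i < D) P`_i * mellin_mono s i.

Lemma mellinD D s P Q : mellin D s (P + Q) = mellin D s P + mellin D s Q.
Proof. by rewrite -big_split; apply: eq_bigr => i _; rewrite coefD mulrDl. Qed.

Lemma mellinZ D s c P : mellin D s (c *: P) = c * mellin D s P.
Proof. by rewrite mulr_sumr; apply: eq_bigr => i _; rewrite coefZ mulrA. Qed.

Lemma mellin0 D s : mellin D s 0 = 0.
Proof. by rewrite /mellin big1// => i _; rewrite coef0 mul0r. Qed.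

Lemma mellinB D s P Q : mellin D s (P - Q) = mellin D s P - mellin D s Q.
Proof. by rewrite -scaleN1r mellinD mellinZ mulN1r. Qed.

Lemma mellin_sum D s (I : Type) (r : seq I) (P : pred I) (F : I -> {poly R}) :
  mellin D s (\sum_(i <- r | P i) F i) = \sum_(i <- r | P i) mellin D s (F i).
Proof.
by apply: (big_morph (mellin D s)); [exact: mellinD|exact: mellin0].
Qed.

Lemma mellinXn D s i : (i < D)%N -> mellin D s 'X^i = mellin_mono s i.
Proof.
move=> iD; rewrite /mellin (bigD1 (Ordinal iD))//= coefXn eqxx mul1r big1 ?addr0//.
by move=> j; rewrite coefXn -val_eqE /= => /negPf ->; rewrite mul0r.
Qed.

Lemma mellinX D s P : mellin D.+1 s ('X * P) = (s + 1) / (s + b + 2) * mellin D (s + 1) P.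
Proof.
rewrite /mellin big_ord_recl coefXM/= mul0r add0r mulr_sumr; apply: eq_bigr => i _.
rewrite coefXM/= /mellin_mono !pochSl.
have -> : s + b + 2 + 1 = s + 1 + b + 2 by ring.
by rewrite invfM; ring.
Qed.

Lemma poly_eq0_large (Q : {poly R}) s0 : (forall s, s0 <= s -> Q.[s] = 0) -> Q = 0.
Proof.
move=> h; apply: (@roots_geq_poly_eq0 _ _ [seq s0 + k%:R | k <- iota 0 (size Q)]).
- by apply/allP => _ /mapP[k _ ->]; rewrite rootE h// lerDl ler0n.
- rewrite map_inj_uniq ?iota_uniq// => i j /addrI/eqP.
  by rewrite eqr_nat => /eqP.
- by rewrite size_map size_iota.
Qed.

(** As a function of s, the transform of x^i has its last pole at
    s = -(b + 1 + i), with nonzero residue; so the leading term of P cannot be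
    cancelled by the others.  The proof clears the denominators and evaluates the
    resulting polynomial at that point. *)
Lemma mellin_inj D s0 (P : {poly R}) : (size P <= D)%N ->
  (forall s, s0 <= s -> mellin D s P = 0) -> P = 0.
Proof.
move=> sP h; apply/eqP; apply: contraT => P0.
have [d dE] : exists d, size P = d.+1.
  by exists (size P).-1; rewrite prednK// lt0n size_poly_eq0.
pose pX (c : R) e : {poly R} := \prod_(0 <= m < e) ('X + (c + m%:R)%:P).
have pXE c e x : (pX c e).[x] = poch (x + c) e.
  by rewrite /pX horner_prod; apply: eq_bigr => m _; rewrite hornerD hornerX hornerC addrA.
pose Q := \sum_(i < d.+1) P`_i *: (pX 1 i * pX (b + 2 + i%:R) (d - i)%N).
have Q0 : Q = 0.
  apply: (@poly_eq0_large Q (Num.max s0 0)) => s; rewrite ge_max => /andP[s0s s00].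
  have den : poch (s + b + 2) d != 0.
    by rewrite gt_eqF// poch_gt0//; have := hb; lra.
  have : poch (s + b + 2) d * mellin D s P = 0 by rewrite h// mulr0.
  move=> h00; rewrite -[RHS]h00 /Q horner_sum /mellin mulr_sumr.
  rewrite (big_ord_widen_cond D xpredT
    (fun i => (P`_i *: (pX 1 i * pX (b + 2 + i%:R) (d - i)%N)).[s]));
    last by rewrite -dE.
  rewrite [LHS]big_mkcond/=; apply: eq_bigr => i _; case: ltnP => id; last first.
    by rewrite nth_default ?mul0r ?mulr0// dE.
  rewrite hornerZ hornerM !pXE /mellin_mono -{2}(subnKC (id : (i <= d)%N)) pochD.
  have -> : s + (b + 2 + i%:R) = s + b + 2 + i%:R by ring.
  have h1 : poch (s + b + 2) i != 0.
    by rewrite gt_eqF// poch_gt0//; have := hb; lra.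
  by field.
(* At this point (s + b + 2 + i)_(d - i) vanishes for all i < d. *)
have : Q.[- (b + 1 + d%:R)] = 0 by rewrite Q0 horner0.
rewrite /Q horner_sum big_ord_recr/= big1 ?add0r; last first.
  move=> i _; rewrite hornerZ hornerM !pXE.
  have -> : (d - i = (d - i).-1.+1)%N by rewrite prednK// subn_gt0.
  rewrite [poch _ (_.+1)]pochSr.
  have -> : - (b + 1 + d%:R) + (b + 2 + i%:R) + (d - i).-1%:R = 0.
    have -> : (d - i).-1%:R = d%:R - i%:R - 1 :> R.
      by rewrite -subn1 natrB ?subn_gt0// natrB// ltnW.
    by ring.
  by rewrite !mulr0.
rewrite subnn hornerZ hornerM !pXE poch0 mulr1 => /eqP.
have -> : P`_d = lead_coef P by rewrite lead_coefE dE.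
rewrite mulf_eq0 lead_coef_eq0 (negPf P0)/= => /negPn/negP; case.
apply: poch_neq0 => m md; rewrite lt_eqF//.
have : m.+1%:R <= d%:R :> R by rewrite ler_nat.
by rewrite -natr1; have := hb; lra.
Qed.

(** The zeros s = a_q + m, m < n_q, of the transform are the orthogonality
    conditions. *)
Lemma mellin_typeII D n s : (mlen n < D)%N -> 0 < s ->
  (forall q, a q + b + 2 * (mlen n)%:R + 1 < s) ->
  mellin D s (typeII a b n) =
    mellin_scale a n b * (\prod_q fall (s - a q) (n q)) / poch (s + b + 2) (mlen n).
Proof.
move=> nD s0 hs; rewrite /typeII mellin_sum.
transitivity ((-1) ^+ mlen n
  * (\prod_(q < p) (poch (a q + 1) (n q) / poch (a q + b + (mlen n)%:R + 1) (n q))) *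
  \sum_(l : {ffun 'I_p -> 'I_(mlen n).+1} | [forall q, (l q <= n q)%N])
     typeII_reg_prod a b n (fun q => l q)
     * (poch (s + 1) (ltail (fun q => l q) 0)
        / poch (s + b + 2) (ltail (fun q => l q) 0))).
  rewrite mulr_sumr; apply: eq_bigr => l /forallP hl.
  rewrite mellinZ mellinXn; last by apply: leq_ltn_trans nD; exact: leq_sum.
  by rewrite typeII_coefE /typeII_reg /mellin_mono ltail0 !mulrA.
rewrite mellin_multisum//; last by move=> q; exact: leq_mlen1.
rewrite /mellin_scale.
have -> : \prod_(q < p) fall (s - a q) (n q)
  = (-1) ^+ mlen n * \prod_(q < p) poch (a q - s) (n q).
  rewrite /mlen -prodrXr -big_split/=; apply: eq_bigr => q _.
  by rewrite -[a q - s]opprB poch_fall mulrA -exprMn mulrNN mulr1 expr1n mul1r.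
have -> : \prod_(q < p) poch (a q + b + 1 + (mlen n)%:R) (n q)
  = \prod_(q < p) poch (a q + b + (mlen n)%:R + 1) (n q).
  by apply: eq_bigr => q _; rewrite addrAC.
rewrite !big_split/= !prodfV.
have h1 : \prod_(q < p) poch (a q + 1) (n q) != 0.
  by apply/prodf_neq0 => q _; rewrite gt_eqF// poch_gt0// -ltrBlDr sub0r.
move: (\prod_(q < p) poch (a q + b + _ + 1) (n q))^-1 (poch (s + b + 2) _)^-1.
by move=> x1 x2; field.
Qed.

Lemma size_typeII n : (size (typeII a b n) <= (mlen n).+1)%N.
Proof.
rewrite /typeII; apply: (leq_trans (size_sum _ _ _)); apply/bigmax_leqP => l /forallP hl.
apply: (leq_trans (size_scale_leq _ _)); rewrite size_polyXn ltnS.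
exact: leq_sum.
Qed.

End TypeII.

Section RecII_final.
Variables (R : realType) (p : nat) (a : 'I_p -> R) (b : R) (pi : 'S_p) (k : 'I_p).
Hypothesis ha : forall i : 'I_p, -1 < a i.
Hypothesis hb : -1 < b.
Hypothesis haZ : forall i j : 'I_p, i != j -> a i - a j \isn't a Num.int.
Variable n : 'I_p -> nat.
Hypothesis hn : forall i j : 'I_p, (i <= j)%N -> n (pi i) = 0%N -> n (pi j) = 0%N.

Let N := mlen n.
Let w := node a n.
Let u := a k + (n k)%:R + 1.

Lemma cont_mellin_scale m : cont b (mellin_scale a m).
Proof.
apply: contM; first by apply: (@cont_pochA _ _ 0 1) => y; rewrite add0r.
apply: contV.
  apply/prodf_neq0 => q _; have := poch_shift_neq0 ha hb m q.
  by rewrite addrAC.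
apply: cont_prod => q _; by apply: (@cont_pochA _ _ (a q) (1 + (mlen m)%:R)) => y; ring.
Qed.

Lemma mle_svec_gt0 (j : 'I_p) q : mle (svec pi j.+1) n -> q \notin Sset pi j.+1 -> (0 < n q)%N.
Proof.
move=> /forallP/(_ q) + qS; apply: leq_trans.
by move: qS; rewrite in_Sset -ltnNge svecE => /ltnW; rewrite -ltnS => ->.
Qed.

Lemma mle_svec_leq (j : 'I_p) : mle (svec pi j.+1) n -> (j.+1 <= mlen n)%N.
Proof. by move=> /leq_mlen; rewrite mlen_svec. Qed.

(** [typeII_base_generic] at the given beta, where b^j is a limit: both sides
    are continuous in beta once written with [bcoef_reg]. *)
Lemma typeII_base t :
  mellin_scale a n b * (t * \prod_q (t - a q)) =
    mellin_scale a (madd n (evec k)) b * ((t - u) * \prod_q (t - w q))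
    + bcoef0 a b n k * mellin_scale a n b * ((t + b + 1 + N%:R) * \prod_q (t - w q))
    + \sum_(j < p) (if mle (svec pi j.+1) n
           then bcoef a b pi n j.+1 * mellin_scale a (msub n (svec pi j.+1)) b else 0)
        * (poch (t + b + N%:R - j%:R) (j + 2)
           * \prod_(q in Sset pi j.+2) (t - w q)).
Proof.
pose f y := mellin_scale a n y * (t * \prod_q (t - a q)).
pose g y := mellin_scale a (madd n (evec k)) y * ((t - u) * \prod_q (t - w q))
    + bcoef0 a y n k * mellin_scale a n y * ((t + y + 1 + N%:R) * \prod_q (t - w q))
    + \sum_(j < p) (if mle (svec pi j.+1) n
           then bcoef_reg a pi n j.+1 y * mellin_scale a (msub n (svec pi j.+1)) y else 0)
        * (poch (t + y + N%:R - j%:R) (j + 2)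
           * \prod_(q in Sset pi j.+2) (t - w q)).
transitivity (g b); last first.
  congr (_ + _); apply: eq_bigr => j _; case: ifP => // le_s.
  rewrite bcoefE//; first exact: mle_svec_leq.
  by move=> q; exact: mle_svec_gt0.
apply: (@eq_punctured _ b f g).
- near=> y.
  have [hy _] : (forall q, a q + y \isn't a Num.int) /\ -1 < y.
    by near: y; exact: near_generic.
  rewrite /f (typeII_base_generic k haZ hy t hn); congr (_ + _).
  apply: eq_bigr => j _; case: ifP => // le_s; rewrite bcoef_reg_generic// => q.
  exact: mle_svec_gt0.
- by apply: contM; [exact: cont_mellin_scale|exact: cont_cst].
- apply: contD.
    apply: contD.
      by apply: contM; [exact: cont_mellin_scale|exact: cont_cst].
    apply: contM.
      by apply: contM; [exact: cont_bcoef0|exact: cont_mellin_scale].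
    apply: contM; last exact: cont_cst.
    by apply: (cont_eq (@cont_affine _ b t (1 + N%:R))) => y; ring.
  apply: cont_sum => j _; apply: contM.
    have [le_s|_] := boolP (mle (svec pi j.+1) n); last exact: cont_cst.
    apply: contM; [by apply: cont_bcoef_reg => //; exact: mle_svec_leq|].
    exact: cont_mellin_scale.
  apply: contM; last exact: cont_cst.
  by apply: (@cont_pochA _ _ t (N%:R - j%:R)) => y; ring.
Unshelve. all: by end_near. Qed.

(** The restriction s > a_q + n_q makes all factors of [phi] finite, and the last
    one is the hypothesis of the Saalschutz sum for all the multi-indices in the
    recurrence. *)
Let large s := [/\ 0 < s, (forall q, a q + (n q)%:R < s) &
  (forall q, a q + b + 2 * (N%:R + 1) + 1 < s)].

Lemma large_ex : exists s0, forall s, s0 <= s -> large s.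
Proof.
exists (1 + \sum_q `|a q| + `|b| + 2 * (N%:R + 1) + 1) => s hs.
have S0 : 0 <= \sum_(q < p) `|a q| by apply: sumr_ge0 => q _.
have aS q : a q <= \sum_(q < p) `|a q|.
  apply: (le_trans (ler_norm _)); rewrite (bigD1 q)//= lerDl.
  by apply: sumr_ge0 => *.
have b0 : 0 <= `|b| by [].
have bb : b <= `|b| by exact: ler_norm.
have N0 : 0 <= N%:R :> R by rewrite ler0n.
split.
- by lra.
- move=> q; have := aS q.
  have : (n q)%:R <= N%:R :> R by rewrite ler_nat leq_mlen1.
  by lra.
- by move=> q; have := aS q; lra.
Qed.

(** The factor common to the transforms of all polynomials in the recurrence. *)
Let phi s : R := (\prod_q (fall (s - a q) (n q) / (s + 1 - w q)))
     / poch (s + b + 2) N.+1.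

Let sw s q : large s -> s + 1 - w q != 0.
Proof.
move=> [_ h _]; have := h q; rewrite /w /node => h1.
by rewrite gt_eqF//; lra.
Qed.

Let sb s e : large s -> poch (s + b + 2) e != 0.
Proof.
by move=> [h _ _]; have hb1 := hb; rewrite gt_eqF// poch_gt0//; lra.
Qed.

Lemma mellin_X s D : large s -> (N < D)%N ->
  mellin b D.+1 s ('X * typeII a b n)
  = mellin_scale a n b * ((s + 1) * \prod_q (s + 1 - a q)) * phi s.
Proof.
move=> ls ND; have [s0 h1 h2] := ls; have hb1 := hb.
rewrite mellinX mellin_typeII//; last 2 first.
- by lra.
- by move=> q; have := h2 q; have := ler0n R N; rewrite -/N; lra.
rewrite -/N /phi pochSl.
have -> : s + 1 + b + 2 = s + b + 2 + 1 by ring.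
have -> : \prod_q fall (s + 1 - a q) (n q) =
  (\prod_q (s + 1 - a q)) * \prod_q (fall (s - a q) (n q) / (s + 1 - w q)).
  rewrite -big_split/=; apply: eq_bigr => q _.
  have := fallS_shift (s - a q) (n q).
  have -> : s - a q + 1 = s + 1 - a q by ring.
  have -> : s + 1 - a q - (n q)%:R = s + 1 - w q by rewrite /w /node; ring.
  by move=> e; rewrite mulrA -e mulfK// sw.
by rewrite invfM; ring.
Qed.

Lemma mellin_n s D : large s -> (N < D)%N ->
  mellin b D s (typeII a b n)
  = mellin_scale a n b * ((s + 1 + b + 1 + N%:R) * \prod_q (s + 1 - w q)) * phi s.
Proof.
move=> ls ND; have [s0 h1 h2] := ls; have hb1 := hb.
rewrite mellin_typeII//; last first.
  by move=> q; have := h2 q; have := ler0n R N; rewrite -/N; lra.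
rewrite -/N /phi pochSr.
have -> : \prod_q fall (s - a q) (n q) =
  (\prod_q (s + 1 - w q)) * \prod_q (fall (s - a q) (n q) / (s + 1 - w q)).
  rewrite -big_split/=; apply: eq_bigr => q _.
  by rewrite mulrC mulfVK// sw.
have h3 : s + b + 2 + N%:R != 0.
  by have := ler0n R N => N0; rewrite gt_eqF//; lra.
have h4 := sb N ls.
by field; rewrite h3 h4.
Qed.

Lemma mellin_next s D : large s -> (N.+1 < D)%N ->
  mellin b D s (typeII a b (madd n (evec k)))
  = mellin_scale a (madd n (evec k)) b * ((s + 1 - u) * \prod_q (s + 1 - w q)) * phi s.
Proof.
move=> ls ND; have [s0 h1 h2] := ls.
have NE : mlen (madd n (evec k)) = N.+1 by rewrite mlenD mlen_evec addn1.
rewrite mellin_typeII//; last 2 first.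
- by rewrite NE.
- by move=> q; have := h2 q; rewrite NE -[N.+1%:R]natr1.
rewrite NE /phi.
have -> : \prod_q fall (s - a q) (madd n (evec k) q) =
  (s + 1 - u) * (\prod_q (s + 1 - w q)) * \prod_q (fall (s - a q) (n q) / (s + 1 - w q)).
  rewrite [X in X * _ * _](prod_at k) -!big_split/=; apply: eq_bigr => q _.
  rewrite -mulrA [X in _ * X]mulrC mulfVK ?sw// /madd /evec.
  case: eqVneq => [->|_] /=; last by rewrite addn0 mul1r.
  by rewrite addn1 fallSr mulrC /u; congr (_ * _); ring.
by ring.
Qed.

Lemma mellin_prev s D (j : 'I_p) : large s -> (N < D)%N -> mle (svec pi j.+1) n ->
  mellin b D s (typeII a b (msub n (svec pi j.+1)))
  = mellin_scale a (msub n (svec pi j.+1)) b * (poch (s + 1 + b + N%:R - j%:R) (j + 2)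
           * \prod_(q in Sset pi j.+2) (s + 1 - w q)) * phi s.
Proof.
move=> ls ND le_s; have [s0 h1 h2] := ls.
have NE : mlen (msub n (svec pi j.+1)) = (N - j.+1)%N by rewrite mlenB// mlen_svec.
have jN := mle_svec_leq le_s.
rewrite mellin_typeII//; last 2 first.
- by rewrite NE (leq_ltn_trans _ ND)// leq_subr.
- move=> q; apply: le_lt_trans (h2 q).
  have : (mlen (msub n (svec pi j.+1)))%:R <= N%:R :> R by rewrite NE ler_nat leq_subr.
  by lra.
rewrite NE /phi.
have -> : poch (s + b + 2) N.+1 = poch (s + b + 2) (N - j.+1)
    * poch (s + 1 + b + N%:R - j%:R) (j + 2).
  have -> : N.+1 = (N - j.+1 + (j + 2))%N by move: jN; rewrite -/N; lia.
  rewrite pochD natrB//; congr (_ * poch _ _).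
  by rewrite -natr1; ring.
have -> : \prod_q fall (s - a q) (msub n (svec pi j.+1) q) =
  (\prod_(q in Sset pi j.+2) (s + 1 - w q)) * \prod_q (fall (s - a q) (n q) / (s + 1 - w q)).
  rewrite [X in _ = X * _]big_mkcond -big_split/=; apply: eq_bigr => q _.
  rewrite in_Sset /msub svecE ltnS.
  case: (leqP (pi^-1%g q) j) => qj; last first.
    by rewrite subn0 mulrC mulfVK ?sw.
  have nq : (0 < n q)%N.
    by have /forallP/(_ q) := le_s; rewrite svecE ltnS qj.
  rewrite mul1r subn1.
  have -> : s + 1 - w q = s - a q - (n q).-1%:R.
    by rewrite /w /node -{1}(prednK nq) -natr1; ring.
  have h : s - a q - (n q).-1%:R != 0.
    have := sw q ls; rewrite /w /node -{1}(prednK nq) -natr1.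
    by congr (_ != 0); ring.
  by rewrite -[in RHS](prednK nq) fallSr mulfK.
have h3 := sb (N - j.+1) ls.
have h4 : poch (s + 1 + b + N%:R - j%:R) (j + 2) != 0.
  have hb1 := hb.
  have jR : j.+1%:R <= N%:R :> R by rewrite ler_nat.
  by rewrite gt_eqF// poch_gt0//; move: jR; rewrite -natr1; lra.
by field; rewrite h3 h4.
Qed.

Lemma typeII_recurrence :
  'X * typeII a b n =
       typeII a b (madd n (evec k)) + bcoef0 a b n k *: typeII a b n
       + \sum_(1 <= j < p.+1)
           bcoef a b pi n j *: typeII_sub a b n (svec pi j).
Proof.
rewrite big_add1 big_mkord; set RHS := (X in _ = X).
apply/eqP; rewrite -subr_eq0; apply/eqP.
have NE : mlen (madd n (evec k)) = N.+1 by rewrite mlenD mlen_evec addn1.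
have [s0 hs] := large_ex.
apply: (@mellin_inj _ b hb N.+2 s0).
  apply: (leq_trans (size_polyD _ _)); rewrite size_polyN geq_max; apply/andP; split.
    apply: leq_trans (size_polyMleq _ _) _; rewrite size_polyX.
    by rewrite /= ltnS size_typeII.
  apply: (leq_trans (size_polyD _ _)); rewrite geq_max; apply/andP; split.
    apply: (leq_trans (size_polyD _ _)); rewrite geq_max; apply/andP; split.
      by rewrite -NE size_typeII.
    apply: (leq_trans (size_scale_leq _ _)); apply: (leq_trans (size_typeII _ _ _)).
    exact: leqnSn.
  apply: (leq_trans (size_sum _ _ _)); apply/bigmax_leqP => j _.
  apply: (leq_trans (size_scale_leq _ _)); rewrite /typeII_sub; case: ifP => le_s.
    apply: (leq_trans (size_typeII _ _ _)); rewrite mlenB// ltnS.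
    by rewrite (leq_trans (leq_subr _ _)).
  by rewrite size_poly0.
move=> s /hs ls.
rewrite mellinB /RHS !mellinD mellinZ mellin_X// mellin_next// mellin_n// mellin_sum.
rewrite typeII_base; apply/eqP; rewrite subr_eq0; apply/eqP.
rewrite 2!mulrDl; congr (_ + _ + _); first by ring.
rewrite mulr_suml; apply: eq_bigr => j _; rewrite mellinZ /typeII_sub.
case: ifP => le_s; last by rewrite mellin0 mulr0 !mul0r.
by rewrite mellin_prev//; ring.
Qed.

End RecII_final.

(** * The functional equation of Gamma *)

Section Gamma.
Local Open Scope classical_set_scope.
Variable R : realType.
Implicit Types (z t : R).
Notation mu := (@lebesgue_measure R).

Definition gamma_fun z t : R := t `^ (z - 1) * expR (- t).

Lemma gamma_fun_ge0 z t : 0 <= gamma_fun z t.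
Proof. by rewrite mulr_ge0 ?powR_ge0 ?expR_ge0. Qed.

Lemma measurable_gamma_fun z (D : set R) : measurable_fun D (gamma_fun z).
Proof.
apply: measurable_funTS; apply: measurable_funM; first exact: measurable_powR.
by apply: measurableT_comp; [exact: measurable_expR|exact: oppr_measurable].
Qed.

Lemma is_deriveN_expRN t : is_derive t 1 (fun t => - expR (- t)) (expR (- t)).
Proof.
have h : is_derive t 1 (fun t : R => expR (- t)) (- expR (- t)).
  by apply: (is_derive_eq (is_derive1_comp _ _)); rewrite mulrN1.
by apply: (is_derive_eq (is_deriveN h)); rewrite opprK.
Qed.

(** On a segment away from 0 and infinity, so that both integrals are of continuous
    functions. *)
Lemma gamma_fun_by_parts z (c e : R) : 0 < z -> 0 < c -> c < e ->
  (\int[mu]_(t in `[c, e]) (gamma_fun (z + 1) t)%:E =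
   (c `^ z * expR (- c) - e `^ z * expR (- e))%:E
   + z%:E * \int[mu]_(t in `[c, e]) (gamma_fun z t)%:E)%E.
Proof.
move=> z0 c0 ce.
have pos t : t \in `[c, e]%R -> 0 < t.
  by rewrite in_itv/= => /andP[ct _]; exact: lt_le_trans ct.
have poso t : t \in `]c, e[%R -> 0 < t.
  by rewrite in_itv/= => /andP[ct _]; exact: lt_trans ct.
have dpow y t : 0 < t -> derivable (fun t : R => t `^ y) t 1.
  by move=> t0; have [] := @is_derive1_powR R y t t0.
have dexp t : derivable (fun t : R => - expR (- t)) t 1.
  by have [] := is_deriveN_expRN t.
have dexp' t : derivable (fun t : R => expR (- t)) t 1.
  have -> : (fun t : R => expR (- t)) = - (fun t : R => - expR (- t)).
    by apply/funext => x /=; rewrite opprK.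
  exact: derivableN.
have ccont (f : R -> R) t : derivable f t 1 -> f x @[x --> t] --> f t.
  by move=> /derivable1_diffP/differentiable_continuous.
have LR (f : R -> R) : (forall t, 0 < t -> derivable f t 1) ->
    derivable_oo_LRcontinuous f c e.
  move=> df; split; first by move=> t tce; apply: df; exact: poso.
  - by apply: cvg_at_right_filter; apply: ccont; exact: df.
  - by apply: cvg_at_left_filter; apply: ccont; apply: df; exact: lt_trans ce.
have cont_g : {within `[c, e], continuous (fun t => z * t `^ (z - 1))}.
  apply: derivable_within_continuous => t tce; apply: derivableM => //.
  by apply: dpow; exact: pos.
have cont_e : {within `[c, e], continuous (fun t : R => expR (- t))}.
  by apply: derivable_within_continuous => t tce.
have D1 : {in `]c, e[%R, (fun t : R => t `^ z)^`() =1 (fun t => z * t `^ (z - 1))}.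
  move=> t tce; rewrite derive1E; have t0 := poso t tce.
  by rewrite (derive_val (is_derive := is_derive1_powR z t0)).
have D2 : {in `]c, e[%R, (fun t : R => - expR (- t))^`() =1 (fun t => expR (- t))}.
  by move=> t tce; rewrite derive1E (derive_val (is_derive := is_deriveN_expRN t)).
have := integration_by_parts ce cont_g (LR _ (dpow z)) D1 cont_e (LR _ (fun t _ => dexp t)) D2.
under eq_integral => t _.
  rewrite (_ : t `^ z * expR (- t) = gamma_fun (z + 1) t); last by rewrite /gamma_fun addrK.
  over.
move=> ->.
have -> : (e `^ z * - expR (- e) - c `^ z * - expR (- c))
    = c `^ z * expR (- c) - e `^ z * expR (- e) by ring.
congr (_ + _)%E.
under eq_integral => t _.
  rewrite (_ : (z * t `^ (z - 1) * - expR (- t))%:E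
      = - (z%:E * (gamma_fun z t)%:E))%E; last first.
    by rewrite -EFinM -EFinN /gamma_fun mulrN mulrA.
  over.
rewrite integral_ge0N; last first.
  by move=> t _; rewrite -EFinM lee_fin mulr_ge0// ?gamma_fun_ge0// ltW.
rewrite oppeK ge0_integralZl_EFin//; first by move=> t _; rewrite lee_fin gamma_fun_ge0.
- by apply/measurable_EFinP; exact: measurable_gamma_fun.
- exact: ltW.
Qed.

Let h (m : nat) : R := m.+2%:R.
Let A (m : nat) : set R := `[(h m)^-1, h m].

Lemma bigcup_A : \bigcup_m A m = `]0, +oo[.
Proof.
apply/seteqP; split => [t [m _]|t] /=; rewrite /A /= !in_itv/= ?andbT.
  by move=> /andP[+ _]; apply: lt_le_trans; rewrite invr_gt0 ltr0n.
move=> t0; exists (Num.bound t + Num.bound t^-1)%N => //=.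
have h1 : t < (Num.bound t)%:R by have := archi_boundP (ltW t0).
have h2 : t^-1 < (Num.bound t^-1)%:R by apply: archi_boundP; rewrite invr_ge0 ltW.
have hh : h (Num.bound t + Num.bound t^-1)%N = (Num.bound t)%:R + (Num.bound t^-1)%:R + 2.
  by rewrite /h -addn2 !natrD.
have b1 := ler0n R (Num.bound t); have b2 := ler0n R (Num.bound t^-1).
rewrite in_itv/= hh; apply/andP; split; last by lra.
rewrite -[leRHS]invrK lef_pV2 ?posrE ?invr_gt0//; lra.
Qed.

Lemma nd_A : nondecreasing_seq A.
Proof.
move=> m1 m2 m12; rewrite subsetEset /A => t /=; rewrite !in_itv/= => /andP[h1 h2].
have hh : h m1 <= h m2 by rewrite /h ler_nat !ltnS.
have h0 m : 0 < h m by rewrite /h ltr0n.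
by rewrite (le_trans _ h1) ?(le_trans h2)// lef_pV2 ?posrE.
Qed.

Lemma cvg_gamma_fun z : (\int[mu]_(t in A m) (gamma_fun z t)%:E @[m --> \oo]
   --> \int[mu]_(t in `]0%R, +oo[) (gamma_fun z t)%:E)%E.
Proof.
rewrite -bigcup_A; apply: ge0_nondecreasing_set_cvg_integral.
- exact: nd_A.
- by move=> m; exact: measurable_itv.
- by move=> m; apply/measurable_EFinP; exact: measurable_gamma_fun.
- by move=> m t _; rewrite lee_fin gamma_fun_ge0.
Qed.

Lemma cvg_invh : (h m)^-1 @[m --> \oo] --> (0 : R).
Proof.
apply: (@squeeze_cvgr _ _ _ _ (cst 0) (@harmonic R)).
- apply: nearW => m; rewrite /h /harmonic /= invr_ge0 ler0n/=.
  by rewrite lef_pV2 ?posrE ?ltr0n// ler_nat.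
- exact: cvg_cst.
- exact: cvg_harmonic.
Qed.

Lemma cvg_bound_low z : 0 < z -> (h m)^-1 `^ z * expR (- (h m)^-1) @[m --> \oo] --> (0 : R).
Proof.
move=> z0; apply: (@squeeze_cvgr _ _ _ _ (cst 0) (fun m => (h m)^-1 `^ z)).
- apply: nearW => m; have h0 : 0 < (h m)^-1 by rewrite invr_gt0 ltr0n.
  rewrite mulr_ge0 ?powR_ge0 ?expR_ge0//= ler_piMr ?powR_ge0//.
  by rewrite expR_le1 oppr_le0 ltW.
- exact: cvg_cst.
- have /cvg_at_rightP := powR_cvg0 z0; apply; split; last exact: cvg_invh.
  by move=> m; rewrite invr_gt0 ltr0n.
Qed.

(** The exponential series gives e^h >= h^(e+1) / (e+1)!. *)
Lemma cvg_bound_high z : h m `^ z * expR (- h m) @[m --> \oo] --> (0 : R).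
Proof.
pose e := Num.bound `|z|.
have ze : z <= e%:R.
  by rewrite ltW// (le_lt_trans (ler_norm _))// archi_boundP.
apply: (@squeeze_cvgr _ _ _ _ (cst 0) (fun m => e.+1`!%:R * (h m)^-1)).
- apply: nearW => m; have h0 : 0 < h m by rewrite ltr0n.
  have h1 : 1 <= h m by rewrite ler1n.
  rewrite mulr_ge0 ?powR_ge0 ?expR_ge0//=.
  apply: (@le_trans _ _ (h m ^+ e * expR (- h m))).
    rewrite ler_wpM2r ?expR_ge0// -powR_mulrn; first exact: (ler_powR h1 ze).
    exact: ltW.
  rewrite expRN ler_pdivrMr ?expR_gt0// mulrAC ler_pdivlMr// -exprSr.
  have f0 : 0 < e.+1`!%:R :> R by rewrite ltr0n fact_gt0.
  rewrite mulrC -ler_pdivrMr//.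
  by apply: le_trans (expR_ge1Dxn e (ltW h0)); rewrite lerDr.
- exact: cvg_cst.
- have -> : 0 = e.+1`!%:R * 0 :> R by rewrite mulr0.
  by apply: cvgM; [exact: cvg_cst|exact: cvg_invh].
Qed.

(** The equation is first proved for the extended-real integrals, where monotone
    convergence along the segments [A m] applies without any integrability
    hypothesis. *)
Lemma GammaS z : 0 < z -> Gamma (z + 1) = z * Gamma z.
Proof.
move=> z0.
have e : (\int[mu]_(t in `]0%R, +oo[) (gamma_fun (z + 1) t)%:E
   = z%:E * \int[mu]_(t in `]0%R, +oo[) (gamma_fun z t)%:E)%E.
  apply: (cvg_unique _ (@cvg_gamma_fun (z + 1))) => //.
  have -> : (fun m => \int[mu]_(t in A m) (gamma_fun (z + 1) t)%:E)%E =
    (fun m => ((h m)^-1 `^ z * expR (- (h m)^-1) - h m `^ z * expR (- h m))%:E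
       + z%:E * \int[mu]_(t in A m) (gamma_fun z t)%:E)%E.
    apply/funext => m; rewrite /A gamma_fun_by_parts// ?invr_gt0 ?ltr0n//.
    by rewrite (@lt_trans _ _ 1)// ?invf_lt1 ?ltr1n ?ltr0n.
  rewrite -[(z%:E * \int[mu]_(t in `]0%R, +oo[) _)%E]add0e; apply: cvgeD.
  - exact: fin_num_adde_defr.
  - apply: cvg_EFin; first by near=> m.
    by have := cvgB (cvg_bound_low z0) (cvg_bound_high z); rewrite subr0; apply.
  - by apply: cvgeZl => //; exact: cvg_gamma_fun.
have gE y : Gamma y = fine (\int[mu]_(t in `]0%R, +oo[) (gamma_fun y t)%:E)%E by [].
rewrite !gE e.
have : (0 <= \int[mu]_(t in `]0%R, +oo[) (gamma_fun z t)%:E)%E.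
  by apply: integral_ge0 => t _; rewrite lee_fin gamma_fun_ge0.
case: (\int[mu]_(t in _) _)%E => [r _|_|//]; first by rewrite -EFinM.
by rewrite gt0_muley ?lte_fin//= mulr0.
Unshelve. all: by end_near. Qed.

End Gamma.

(** * Type I: recurrence *)

Section RecI_final.
Variables (R : realType) (p : nat) (a : 'I_p -> R) (b : R) (pi : 'S_p) (k i : 'I_p).
Hypothesis ha : forall i : 'I_p, -1 < a i.
Hypothesis hb : -1 < b.
Hypothesis haZ : forall i j : 'I_p, i != j -> a i - a j \isn't a Num.int.
Implicit Types (n : 'I_p -> nat) (l : nat) (y : R).

Lemma Gamma_poch (z : R) m : 0 < z -> Gamma (z + m%:R) = poch z m * Gamma z.
Proof.
move=> z0; elim: m => [|m IHm]; first by rewrite addr0 poch0 mul1r.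
rewrite -natr1 addrA GammaS; last by rewrite ltr_wpDr.
by rewrite IHm pochSr; ring.
Qed.

Lemma fall_ffact (m l : nat) : (l <= m)%N -> fall m%:R l = (m ^_ l)%:R :> R.
Proof.
elim: l => [|l IHl] lm; first by rewrite fall0.
by rewrite fallSr IHl 1?ltnW// ffactnSr natrM natrB// ltnW.
Qed.

Lemma sign_sqr (m : nat) : (-1) ^+ m * (-1) ^+ m = 1 :> R.
Proof. by rewrite -expr2 sqrr_sign. Qed.

(** [residue_coef] divided by a_i + y + 1, in a form that is continuous at
    y = -1 - a_i.  The truncated subtractions are exact when n_i > 0, and
    the last product is 0 when n_i = 0. *)
Definition typeI_reg n l y : R :=
  (\prod_(q < p | q != i) poch (a q + y + (mlen n)%:R) (n q))
  * poch (a i + y + 2) (mlen n + n i - 2) * poch (a i + y + (mlen n)%:R) l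
  / poch (y + 1) (mlen n).-1 / poch (a i + 1) l
  * \prod_q pole_res a i l q (n q).

Lemma prod_pole_res0 n l : (n i <= l)%N -> \prod_q pole_res a i l q (n q) = 0.
Proof. by move=> nl; rewrite (bigD1 i)//= /pole_res eqxx ltnNge nl mul0r. Qed.

Lemma typeI_reg_generic n l y : (a i + y + 1) * typeI_reg n l y = residue_coef a y i n l.
Proof.
rewrite /typeI_reg /residue_coef /residue_scale; set P := \prod_q pole_res _ _ _ _ _.
have [nl|ln] := leqP (n i) l.
  by rewrite /P prod_pole_res0// !mulr0.
have ni : (0 < n i)%N by exact: leq_ltn_trans ln.
have N0 : (0 < mlen n)%N := leq_trans ni (leq_mlen1 _ _).
set N := mlen n in N0 *.
have key : (a i + y + 1) * (poch (a i + y + 2) (N + n i - 2) * poch (a i + y + N%:R) l)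
   = poch (a i + y + N%:R) (n i) * poch (a i + y + 1) (N.-1 + l).
  rewrite mulrA; have -> : a i + y + 2 = a i + y + 1 + 1 by ring.
  rewrite -pochSl.
  have -> : (N + n i - 2).+1 = (N.-1 + n i)%N by lia.
  rewrite !pochD.
  have -> : a i + y + 1 + N.-1%:R = a i + y + N%:R.
    by rewrite -{2}(prednK N0) -natr1; ring.
  ring.
rewrite [\prod_(q < p) poch _ _](bigD1 i)//=.
move: (\prod_(q < p | q != i) _) (poch (y + 1) _)^-1 (poch (a i + 1) l)^-1 => A B C.
transitivity ((a i + y + 1) * (poch (a i + y + 2) (N + n i - 2) * poch (a i + y + N%:R) l)
  * A * B * C * P); first by ring.
by rewrite key; ring.
Qed.

Lemma cont_typeI_reg n l : cont b (typeI_reg n l).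
Proof.
apply: contM; last exact: cont_cst.
apply: contM; last exact: cont_cst.
apply: contM; last first.
  apply: contV; first by rewrite gt_eqF// poch_gt0// -ltrBlDr sub0r.
  by apply: (@cont_pochA _ _ 0 1) => y; rewrite add0r.
apply: contM; last by apply: (@cont_pochA _ _ (a i) (mlen n)%:R) => y.
apply: contM; last by apply: (@cont_pochA _ _ (a i) 2) => y.
by apply: cont_prod => q _; apply: (@cont_pochA _ _ (a q) (mlen n)%:R) => y.
Qed.

(** [residue_coef_recurrence] is divided by a_i + y + 1, which is nonzero for
    generic y, and then extended by continuity. *)
Lemma typeI_reg_recurrence n l : (0 < n k)%N ->
  (if l is l'.+1 then typeI_reg n l' b else 0) =
    typeI_reg (msub n (evec k)) l b + bcoef0 a b (msub n (evec k)) k * typeI_reg n l b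
    + \sum_(j < p) bcoef a b pi (madd n (svec pi j)) j.+1
                   * typeI_reg (madd n (svec pi j.+1)) l b.
Proof.
move=> nk; have N0 : (0 < mlen n)%N := leq_trans nk (leq_mlen1 _ _).
have sv (j q : 'I_p) : q \notin Sset pi j.+1 -> (0 < madd n (svec pi j) q)%N.
  by rewrite in_Sset -ltnNge /madd svecE => ->; rewrite addn1.
have jl (j : 'I_p) : (j.+1 <= mlen (madd n (svec pi j)))%N.
  by rewrite mlenD mlen_svec; [rewrite -add1n leq_add2r|exact: ltnW].
pose f y := (if l is l'.+1 then typeI_reg n l' y else 0).
pose g y := typeI_reg (msub n (evec k)) l y + bcoef0 a y (msub n (evec k)) k * typeI_reg n l y
    + \sum_(j < p) bcoef_reg a pi (madd n (svec pi j)) j.+1 y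
                   * typeI_reg (madd n (svec pi j.+1)) l y.
transitivity (g b); last first.
  congr (_ + _); apply: eq_bigr => j _; rewrite bcoefE// => q; exact: sv.
apply: (@eq_punctured _ b f g).
- near=> y.
  have [hy y1] : (forall q, a q + y \isn't a Num.int) /\ -1 < y.
    by near: y; exact: near_generic.
  have a0 : a i + y + 1 != 0.
    by apply: nonint_neq0; apply: (nonintDB (c := 1) (d := 0) (hy i)); ring.
  apply: (mulfI a0); rewrite /g [RHS]mulrDr [X in _ = X + _]mulrDr.
  rewrite [_ * (bcoef0 _ _ _ _ * _)]mulrCA !typeI_reg_generic mulr_sumr.
  have -> : (a i + y + 1) * f y = (if l is l'.+1 then residue_coef a y i n l' else 0).
    by rewrite /f; case: (l) => [|l']; rewrite ?mulr0// typeI_reg_generic.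
  rewrite (residue_coef_recurrence pi haZ hy y1 nk (ha i)); congr (_ + _).
  apply: eq_bigr => j _; rewrite [RHS]mulrCA typeI_reg_generic bcoef_reg_generic// => q.
  exact: sv.
- by rewrite /f; case: (l) => [|l']; [exact: cont_cst|exact: cont_typeI_reg].
- apply: contD.
    apply: contD; first exact: cont_typeI_reg.
    by apply: contM; [exact: cont_bcoef0|exact: cont_typeI_reg].
  apply: cont_sum => j _; apply: contM; last exact: cont_typeI_reg.
  by apply: cont_bcoef_reg => //; exact: jl.
Unshelve. all: by end_near. Qed.

(** The Gamma factors are reduced to their values at a_i + b + 2 and b + 1,
    which are the same for all n. *)
Lemma coef_typeI n l : (typeI a b n i)`_l =
  Gamma (a i + b + 2) / (Gamma (b + 1) * Gamma (a i + 1)) * typeI_reg n l b.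
Proof.
rewrite /typeI coefZ coef_sum.
have [nl|ln] := leqP (n i) l.
  rewrite /typeI_reg prod_pole_res0// !mulr0 big_nat [X in _ * X]big1 ?mulr0// => m /andP[_ ml].
  by rewrite coefZ coefXn gtn_eqF ?mulr0// (leq_trans ml).
have ni : (0 < n i)%N by exact: leq_ltn_trans ln.
have N0 : (0 < mlen n)%N := leq_trans ni (leq_mlen1 _ _).
rewrite (bigD1_seq l) ?mem_index_iota ?iota_uniq//= [X in _ * (_ + X)]big1; last first.
  by move=> m ml; rewrite coefZ coefXn eq_sym (negPf ml) mulr0.
rewrite addr0 coefZ coefXn eqxx mulr1.
have N1 : 1 <= (mlen n)%:R :> R by rewrite ler1n.
have n1 : 1 <= (n i)%:R :> R by rewrite ler1n.
have hai := ha i; have hb1 := hb.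
have -> : Gamma (a i + b + (mlen n)%:R + (n i)%:R)
  = poch (a i + b + 2) (mlen n + n i - 2) * Gamma (a i + b + 2).
  rewrite -Gamma_poch; last by lra.
  congr Gamma; rewrite natrB; last by lia.
  by rewrite natrD; ring.
have -> : Gamma (b + (mlen n)%:R) = poch (b + 1) (mlen n).-1 * Gamma (b + 1).
  rewrite -Gamma_poch; last by lra.
  by congr Gamma; rewrite -{1}(prednK N0) -natr1; ring.
rewrite /typeI_reg.
have fq q : q != i ->
  (poch (a i - a q - (n q)%:R + 1) l / poch (a i - a q + 1) l) / poch (a q - a i) (n q)
   = (-1) ^+ n q * pole_res a i l q (n q).
  move=> qi; rewrite /pole_res (negPf qi); set x := a i - a q.
  have hx : x \isn't a Num.int by apply: haZ; rewrite eq_sym.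
  have -> : a q - a i = - x by rewrite /x; ring.
  have -> : a i + l%:R - a q = x + l%:R by rewrite /x; ring.
  have e : fall x (n q) * poch (x + 1) l = fall (x + l%:R) (n q) * poch (x - (n q)%:R + 1) l.
    rewrite !fall_poch mulrC [RHS]mulrC.
    have -> : x + 1 = x - (n q)%:R + 1 + (n q)%:R by ring.
    have -> : x + l%:R - (n q)%:R + 1 = x - (n q)%:R + 1 + l%:R by ring.
    by rewrite mulrC pochC.
  have h1 : poch (x + 1) l != 0.
    by apply: nonint_poch; apply: (nonintDB (c := 1) (d := 0) hx); ring.
  have h2 : fall x (n q) != 0.
    apply: fall_neq0 => m _; apply: nonint_neq0.
    by apply: (nonintDB (c := 0) (d := m) hx); ring.
  have h3 : fall (x + l%:R) (n q) != 0.
    apply: fall_neq0 => m _; apply: nonint_neq0.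
    by apply: (nonintDB (c := l) (d := m) hx); ring.
  have -> : poch (x - (n q)%:R + 1) l = fall x (n q) * poch (x + 1) l / fall (x + l%:R) (n q).
    by rewrite e mulrC mulKf.
  rewrite poch_fall.
  have -> : (((-1) ^+ n q) * fall x (n q))^-1 = (-1) ^+ n q / fall x (n q).
    by rewrite invfM invr_sign.
  by field; rewrite h1 h2 h3.
have fi : poch (- (n i)%:R + 1) l / l`!%:R / (n i).-1`!%:R
   = (-1) ^+ (n i).-1 * pole_res a i l i (n i).
  rewrite /pole_res eqxx ln.
  have lm : (l <= (n i).-1)%N by rewrite -ltnS prednK.
  have -> : - (n i)%:R + 1 = - (n i).-1%:R :> R by rewrite -{1}(prednK ni) -natr1; ring.
  rewrite poch_fall fall_ffact// -(ffact_fact lm) natrM.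
  have -> : (-1) ^+ l = (-1) ^+ (n i).-1 * (-1) ^+ ((n i).-1 - l) :> R.
    by rewrite -{1}(subnKC lm) exprD -mulrA sign_sqr mulr1.
  have h1 : (l`!)%:R != 0 :> R by rewrite pnatr_eq0 -lt0n fact_gt0.
  have h2 : (((n i).-1 - l)`!)%:R != 0 :> R by rewrite pnatr_eq0 -lt0n fact_gt0.
  have h3 : ((n i).-1 ^_ l)%:R != 0 :> R by rewrite pnatr_eq0 -lt0n ffact_gt0.
  by field; rewrite h1 h2 h3.
rewrite [\prod_q pole_res _ _ _ _ _](bigD1 i)//=.
have NE : (mlen n).-1 = ((n i).-1 + \sum_(q < p | q != i) n q)%N.
  by rewrite /mlen (bigD1 i)//=; case: (n i) ni.
have sE : (-1) ^+ (mlen n).-1 = (-1) ^+ (n i).-1 * \prod_(q < p | q != i) (-1) ^+ n q :> R.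
  by rewrite NE exprD prodrXr.
have fprod : \prod_(q < p | q != i)
     (poch (a i - a q - (n q)%:R + 1) l / poch (a i - a q + 1) l)
   / \prod_(q < p | q != i) poch (a q - a i) (n q)
  = \prod_(q < p | q != i) (-1) ^+ n q * \prod_(q < p | q != i) pole_res a i l q (n q).
  by rewrite -prodf_div -big_split/=; apply: eq_bigr => q qi; rewrite fq.
rewrite !invfM.
move: fprod; set X1 := \prod_(q < p | q != i) (poch (a i - a q - _ + 1) l / _).
set X2 := (\prod_(q < p | q != i) poch (a q - a i) _)^-1.
set X3 := \prod_(q < p | q != i) pole_res _ _ _ _ _ => fprod.
set X4 := \prod_(q < p | q != i) poch (a q + b + _) _.
move: (poch (a i + b + 2) _) (poch (a i + b + _) l) (poch (b + 1) _)^-1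
  (poch (a i + 1) l)^-1 (Gamma (a i + b + 2)) (Gamma (b + 1))^-1 (Gamma (a i + 1))^-1.
move=> Y1 Y2 Y3 Y4 Y5 Y6 Y7.
transitivity ((-1) ^+ (mlen n).-1 * X4 * Y1 * Y2 * Y3 * Y4 * Y5 * Y6 * Y7 * (X1 * X2)
   * (poch (- (n i)%:R + 1) l / l`!%:R / (n i).-1`!%:R)); first by ring.
rewrite fprod fi.
transitivity ((-1) ^+ (mlen n).-1 * ((-1) ^+ (n i).-1 * \prod_(q < p | q != i) (-1) ^+ n q)
  * (X4 * Y1 * Y2 * Y3 * Y4 * Y5 * Y6 * Y7 * X3 * pole_res a i l i (n i))); first by ring.
by rewrite -sE sign_sqr; ring.
Qed.

Lemma typeI_recurrence n : (0 < n k)%N ->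
  'X * typeI a b n i =
       typeI a b (msub n (evec k)) i
       + bcoef0 a b (msub n (evec k)) k *: typeI a b n i
       + \sum_(1 <= j < p.+1)
           bcoef a b pi (madd n (svec pi j.-1)) j
             *: typeI a b (madd n (svec pi j)) i.
Proof.
move=> nk; apply/polyP => l.
rewrite big_add1 big_mkord !coefD coefXM [X in _ = _ + X + _]coefZ coef_sum !coef_typeI.
set C := Gamma (a i + b + 2) / _.
transitivity (C * (if l is l'.+1 then typeI_reg n l' b else 0)).
  by case: l => [|l]; rewrite ?mulr0.
rewrite (typeI_reg_recurrence _ nk) [LHS]mulrDr [X in X + _ = _]mulrDr.
rewrite [C * (bcoef0 _ _ _ _ * _)]mulrCA; congr (_ + _).
rewrite mulr_sumr; apply: eq_bigr => j _; by rewrite coefZ coef_typeI [RHS]mulrCA.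
Qed.

End RecI_final.

Unset Implicit Arguments.

Theorem theorem2p1 (R : realType) (p : nat) (a : 'I_p -> R) (b : R)
    (pi : 'S_p) (k : 'I_p)
    (ha : forall i : 'I_p, -1 < a i) (hb : -1 < b)
    (haZ : forall i j : 'I_p, i != j -> a i - a j \isn't a Num.int) :
  (* type II: the zero components of n, if any, come last in the order pi *)
  (forall n : 'I_p -> nat,
     (forall i j : 'I_p, (i <= j)%N -> n (pi i) = 0%N -> n (pi j) = 0%N) ->
     'X * typeII a b n =
       typeII a b (madd n (evec k)) + bcoef0 a b n k *: typeII a b n
       + \sum_(1 <= j < p.+1)
           bcoef a b pi n j *: typeII_sub a b n (svec pi j))
  /\
  (* type I: n - e_k is a multi-index *)
  (forall (n : 'I_p -> nat) (i : 'I_p),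
     (0 < n k)%N ->
     'X * typeI a b n i =
       typeI a b (msub n (evec k)) i
       + bcoef0 a b (msub n (evec k)) k *: typeI a b n i
       + \sum_(1 <= j < p.+1)
           bcoef a b pi (madd n (svec pi j.-1)) j
             *: typeI a b (madd n (svec pi j)) i).
Proof.
split=> [n hn|n i nk]; first exact: typeII_recurrence.
exact: typeI_recurrence.
Qed.
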